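(* Let $A$ be a real symmetric positive semi-definite $n\times n$ matrix of rank $r\ge 1$, and let $0<\varepsilon<1$ and $0<\delta<1$. If for some positive integer $N$ the Gaussian trace estimator satisfies $$\Pr\left(\,|tr_G^N(A)-tr(A)|\le \varepsilon\, tr(A)\,\right)\ \ge\ 1-\delta ,$$ then necessarily $$\Phi_{\varepsilon}(Nr)\le \delta ,$$ where, for $0<\theta<1$ and $x>0$, $$\Phi_\theta(x):=P\left(\frac x2,\frac{\tau(1-\theta)x}{2}\right)+Q\left(\frac x2,\frac{\tau(1+\theta)x}{2}\right),\qquad \tau=\frac{\ln(1+\theta)-\ln(1-\theta)}{2\theta}.$$
   Context: $tr(A)$ denotes the trace of $A$. The Gaussian estimator is $tr_G^N(A):=\frac1N\sum_{i=1}^N w_i^t A w_i$, where $w_1,\dots,w_N\in\mathbb{R}^n$ are independent random vectors whose components are all i.i.d. standard normal random variables. $P$ and $Q$ are the regularized Gamma functions $$P(\alpha,\beta):=\frac{\gamma(\alpha,\beta)}{\Gamma(\alpha)},\qquad Q(\alpha,\beta):=\frac{\Gamma(\alpha,\beta)}{\Gamma(\alpha)},$$ where $\gamma(\alpha,\beta)=\int_0^\beta s^{\alpha-1}e^{-s}\,ds$, $\Gamma(\alpha,\beta)=\int_\beta^\infty s^{\alpha-1}e^{-s}\,ds$ and $\Gamma(\alpha)$ are the lower incomplete, upper incomplete and complete Gamma functions. *)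

(* Defs.v *)
From HB Require Import structures.
From mathcomp Require Import all_boot all_order all_algebra.
From mathcomp Require Import all_classical all_reals all_analysis.
Set Implicit Arguments.
Unset Strict Implicit.
Unset Printing Implicit Defensive.
Import Order.TTheory GRing.Theory Num.Theory.
Import numFieldNormedType.Exports.
Local Open Scope classical_set_scope.
Local Open Scope ring_scope.

Definition psdmx (R : realType) (n : nat) (A : 'M[R]_n) : Prop :=
  forall x : 'cV[R]_n, 0 <= (x^T *m A *m x) 0 0.

(* The product rule is required for every subfamily [J] of the finite family
   [X], as needed for mutual (not just pairwise) independence. *)
Definition mutually_independent (R : realType) (d d' : measure_display)
    (T : measurableType d) (T' : measurableType d') (P : probability T R)
    (I : finType) (X : I -> {RV P >-> T'}) : Prop :=
  forall (J : {set I}) (B : I -> set T'),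
    (forall i, i \in J -> measurable (B i)) ->
    P (\bigcap_(i in [set` J]) X i @^-1` B i)
    = (\prod_(i in J) P (X i @^-1` B i))%E.

Arguments mutually_independent {R d d' T T'} P {I} X.

Definition standard_normal (R : realType) (d : measure_display)
    (T : measurableType d) (P : probability T R) (X : {RV P >-> R}) : Prop :=
  forall B : set R, measurable B -> distribution P X B = normal_prob 0 1 B.

Arguments standard_normal {R d T} P X.

(* [w i j] is the [j]-th component of the random vector [w_i].  Mutual
   independence of the family indexed by all pairs [(i, j)] gives both the
   independence of the vectors and the independence of the components within
   each vector. *)
Definition iid_standard_normal_vectors (R : realType) (d : measure_display)
    (T : measurableType d) (P : probability T R) (N n : nat)
    (w : 'I_N -> 'I_n -> {RV P >-> R}) : Prop :=
  mutually_independent P (fun ij : 'I_N * 'I_n => w ij.1 ij.2) /\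
  (forall i j, standard_normal P (w i j)).

Arguments iid_standard_normal_vectors {R d T} P {N n} w.

Definition gaussian_trace (R : realType) (N n : nat) (w : 'I_N -> 'cV[R]_n)
    (A : 'M[R]_n) : R :=
  N%:R^-1 * \sum_(i < N) ((w i)^T *m A *m w i) 0 0.

Section gamma.
Variable R : realType.
Implicit Types a b theta x : R.
Local Notation mu := (@lebesgue_measure R).

(* For [a > 0] all three integrals are finite, so [Rintegral] (real part of the
   extended-real Lebesgue integral) loses nothing.  [0 `^ (a - 1)] has a
   conventional value, on a null set. *)
Definition gamma_integrand a (s : R) : R := s `^ (a - 1) * expR (- s).

Definition lower_gamma a b : R := \int[mu]_(s in `[0, b]) gamma_integrand a s.

Definition upper_gamma a b : R :=
  \int[mu]_(s in `[b, +oo[) gamma_integrand a s.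

Definition Gamma a : R := \int[mu]_(s in `[0, +oo[) gamma_integrand a s.

Definition regP a b : R := lower_gamma a b / Gamma a.

Definition regQ a b : R := upper_gamma a b / Gamma a.

Definition tau theta : R := (ln (1 + theta) - ln (1 - theta)) / (2 * theta).

Definition Phi theta x : R :=
  regP (x / 2) (tau theta * (1 - theta) * x / 2) +
  regQ (x / 2) (tau theta * (1 + theta) * x / 2).

End gamma.

(* Main.v *)
Require Import Defs.
From HB Require Import structures.
From mathcomp Require Import all_boot all_order all_algebra.
From mathcomp Require Import all_classical all_reals all_analysis.
From mathcomp Require Import measurable_realfun ring lra.
Import Order.TTheory GRing.Theory Num.Theory.
Import numFieldNormedType.Exports.
Local Open Scope classical_set_scope.
Local Open Scope ring_scope.

(** Let q(x) = N^-1 sum_i x_i A x_i^T on R^(N n), so that the Gaussian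
    estimator is q(W) for a standard Gaussian vector W, and let
    alpha = N r / 2 with r the rank of A.

    The law of q(W), away from the value 0, is a mixture of rescaled
    Gamma(alpha) laws.  Indeed, if Pi is the orthogonal projection onto the
    space of dimension N r that carries q, then
    q(W) = |Pi W|^2 q(Pi W / |Pi W|), where |Pi W|^2 is twice a Gamma(alpha)
    variable and is independent of the direction of Pi W.  Polar coordinates
    are avoided: [gamma_mixture] multiplies the Gaussian integral by a
    probability density in a scale variable s, exchanges the two integrals and
    substitutes x + (sqrt s - 1) Pi x for x.  This map has Jacobian s^alpha
    ([ge0_integral_orthonormal]) and multiplies both q and |Pi x|^2 by s.

    Under each law of the mixture, the event that q is within eps tr A of tr A
    is the event that a Gamma(alpha) variable falls in a window
    [(1 - eps) c, (1 + eps) c] with c > 0.  The density of Gamma(alpha) is such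
    that this probability is largest at c = tau(eps) alpha
    ([gamma_mass_window_max]), and its value there is 1 - Phi_eps(N r).
    Averaging over the mixture, the event has probability at most
    1 - Phi_eps(N r) ([powm_gauss_window_bound]); as it has probability at
    least 1 - delta, the theorem follows.

    Three ingredients prepare this argument.  The sample has the law of a power
    of the standard normal measure because the two agree on boxes
    ([powm_unique], [flat_sample_law]), and this power has the usual density
    with respect to Lebesgue measure on R^n ([ge0_integral_powm_gauss]).  The
    substitution rule is proved for perturbations of the identity of rank one,
    by induction on the dimension ([ge0_integral_rank1]), and the dilation of
    the range of Pi is a composite of such maps.  An orthonormal basis of the
    row space of A comes from the Gram-Schmidt process
    ([exists_orthonormal_row_basis]). *)

Set Implicit Arguments.
Unset Strict Implicit.

(** * Powers of a sigma-finite measure *)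

Section powm.
Context d (X : measurableType d) (R : realType).
Local Open Scope ereal_scope.

Definition tcons n (p : X * n.-tuple X) : n.+1.-tuple X := [tuple of p.1 :: p.2].

Lemma measurable_tcons n : measurable_fun setT (@tcons n).
Proof. exact: measurable_cons. Qed.

HB.instance Definition _ n := isMeasurableFun.Build _ _ _ _ (@tcons n)
  (@measurable_tcons n).

Definition tuncons n (x : n.+1.-tuple X) : X * n.-tuple X :=
  (thead x, [tuple of behead x]).

Lemma measurable_tuncons n : measurable_fun setT (@tuncons n).
Proof.
apply/measurable_fun_pairP; split.
  exact: (measurable_tnth ord0).
exact: measurable_behead.
Qed.

Lemma tconsK n : cancel (@tcons n) (@tuncons n).
Proof. by move=> [a x]; congr pair; apply/val_inj. Qed.

Section consm.
Variables (n : nat) (mu : {sigma_finite_measure set X -> \bar R})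
  (nu : {sigma_finite_measure set (n.-tuple X) -> \bar R}).

(** Product measures live on pairs; transporting them along [tcons] makes it
    possible to define powers by recursion on the length of the tuple. *)
Definition consm : set (n.+1.-tuple X) -> \bar R :=
  pushforward (mu \x nu) (@tcons n).

Let consm0 : consm set0 = 0. Proof. exact: measure0. Qed.

Let consm_ge0 A : 0 <= consm A. Proof. exact: measure_ge0. Qed.

Let consm_sigma_additive : semi_sigma_additive consm.
Proof. exact: measure_semi_sigma_additive. Qed.

HB.instance Definition _ := isMeasure.Build _ _ _ consm
  consm0 consm_ge0 consm_sigma_additive.

Let consm_sigma_finite : sigma_finite setT consm.
Proof.
have /sigma_finiteP[F [TF ndF Foo]] := sigma_finiteT mu.
have /sigma_finiteP[G [TG ndG Goo]] := sigma_finiteT nu.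
exists (fun k => @tuncons n @^-1` (F k `*` G k)).
  rewrite -preimage_bigcup [X in _ @^-1` X](_ : _ = setT) ?preimage_setT//.
  apply/seteqP; split => // -[a x] _.
  have [i _ Fa] : (\bigcup_i F i) a by rewrite -TF.
  have [j _ Gx] : (\bigcup_i G i) x by rewrite -TG.
  exists (maxn i j) => //; split => /=.
    by move: a Fa; exact/subsetPset/ndF/leq_maxl.
  by move: x Gx; exact/subsetPset/ndG/leq_maxr.
move=> k; have [mF Fk] := Foo k; have [mG Gk] := Goo k; split.
  rewrite -[X in measurable X]setTI; apply: measurable_tuncons => //.
  exact: measurableX.
rewrite /consm /pushforward -comp_preimage.
rewrite (_ : tuncons (n:=n) \o tcons (n:=n) = id) ?preimage_id; last first.
  by apply/funext => p; exact: tconsK.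
by rewrite product_measure1E// lte_mul_pinfty// ge0_fin_numE.
Qed.

HB.instance Definition _ := Measure_isSigmaFinite.Build _ _ _ consm
  consm_sigma_finite.

Lemma ge0_integral_consm (f : n.+1.-tuple X -> \bar R) :
  measurable_fun [set: n.+1.-tuple X] f -> (forall x, 0 <= f x) ->
  \int[consm]_x f x = \int[mu]_a \int[nu]_x f [tuple of a :: x].
Proof.
move=> mf f0; rewrite ge0_integral_pushforward//.
rewrite preimage_setT fubini_tonelli1//=.
by apply: measurableT_comp => //; exact: measurable_tcons.
Qed.

End consm.

Definition nilm : set (0.-tuple X) -> \bar R := \d_[tuple].
HB.instance Definition _ := Measure.on nilm.
HB.instance Definition _ := SigmaFiniteMeasure.on nilm.

Fixpoint powm (mu : {sigma_finite_measure set X -> \bar R}) n :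
    {sigma_finite_measure set (n.-tuple X) -> \bar R} :=
  if n is n'.+1 then consm mu (powm mu n') else nilm.

Lemma ge0_integral_powmS mu n (f : n.+1.-tuple X -> \bar R) :
  measurable_fun [set: n.+1.-tuple X] f -> (forall x, 0 <= f x) ->
  \int[powm mu n.+1]_x f x =
  \int[mu]_a \int[powm mu n]_x f [tuple of a :: x].
Proof. exact: ge0_integral_consm. Qed.

Lemma ge0_integral_powm0 mu (f : 0.-tuple X -> \bar R) :
  measurable_fun [set: 0.-tuple X] f -> \int[powm mu 0]_x f x = f [tuple].
Proof. by move=> mf; rewrite integral_dirac// diracT mul1e. Qed.

Lemma measurable_box n (B : 'I_n -> set X) : (forall i, measurable (B i)) ->
  measurable [set x : n.-tuple X | forall i, B i (tnth x i)].
Proof.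
move=> mB.
rewrite [X in measurable X](_ : _ =
  \bigcap_(i in [set: 'I_n]) ((fun x => tnth x i) @^-1` B i)).
  apply: fin_bigcap_measurable => // i _.
  by have := @measurable_tnth _ X n i measurableT _ (mB i); rewrite setTI.
by apply/seteqP; split => x /= h i; [move=> _; apply: h|apply: h].
Qed.

(** The measure of a box determines the power of a finite measure, see
    [powm_unique]. *)
Lemma powm_box mu n (B : 'I_n -> set X) : (forall i, measurable (B i)) ->
  powm mu n [set x | forall i, B i (tnth x i)] = \prod_(i < n) mu (B i).
Proof.
elim: n B => [|n IH] B mB.
  by rewrite big_ord0 /= /nilm diracE mem_set// => -[].
rewrite big_ord_recl /= /consm /pushforward.
rewrite (_ : _ @^-1` _ = B ord0 `*` [set x | forall i, B (lift ord0 i) (tnth x i)]).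
  rewrite product_measure1E; [congr (_ * _); exact: IH|exact: mB|].
  exact: (@measurable_box n (fun i => B (lift ord0 i))).
apply/seteqP; split => -[a x] /= h.
  split; first by have := h ord0; rewrite tnth0.
  by move=> i; have := h (lift ord0 i); rewrite tnthS.
move=> i; case: h => h0 h.
by case: (unliftP ord0 i) => [j ->|->]; [rewrite tnthS|rewrite tnth0].
Qed.

End powm.

Section powm_unique.
Context d (X : measurableType d) (R : realType).
Local Open Scope ereal_scope.

Definition boxes n : set (set (n.-tuple X)) :=
  [set C | exists2 B : 'I_n -> set X, (forall i, measurable (B i)) &
     C = [set x | forall i, B i (tnth x i)]].

(** Preimages of measurable sets under a coordinate are boxes with all other
    sides full, so the boxes generate the product sigma-algebra. *)
Lemma measurable_boxes n :
  @measurable _ (n.-tuple X) = <<s @boxes n >>.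
Proof.
apply/seteqP; split.
  apply: smallest_sub; first exact: smallest_sigma_algebra.
  rewrite -bigcup_seq; apply: bigcup_sub => i _ _ [A mA <-].
  apply: sub_sigma_algebra.
  exists (fun j => if j == i then A else setT).
    by move=> j; case: ifP.
  rewrite setTI; apply/seteqP; split => x /=.
    by move=> Ax j; case: eqP => // ->.
  by move=> /(_ i); rewrite eqxx.
apply: smallest_sub; first exact: sigma_algebra_measurable.
by move=> _ [B mB ->]; exact: measurable_box.
Qed.

(** Boxes are closed under intersection, so a finite measure is determined by
    its values on them. *)
Lemma powm_unique (mu : {sigma_finite_measure set X -> \bar R}) n
    (m : {measure set (n.-tuple X) -> \bar R}) :
    mu setT < +oo ->
    (forall B : 'I_n -> set X, (forall i, measurable (B i)) ->
      m [set x | forall i, B i (tnth x i)] = \prod_(i < n) mu (B i)) ->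
  forall S, measurable S -> m S = powm mu n S.
Proof.
move=> muoo mE S mS.
apply: (measure_unique (@boxes n) (fun=> setT)) => //.
- exact: measurable_boxes.
- move=> _ _ [B mB ->] [C mC ->]; exists (fun i => B i `&` C i).
    by move=> i; exact: measurableI.
  apply/seteqP; split => x /=; first by move=> [h1 h2] i; split.
  by move=> h; split => i; have [] := h i.
- by move=> i; exists (fun=> setT) => //; apply/seteqP; split.
- by rewrite bigcup_const.
- by move=> _ [B mB ->]; rewrite mE//; apply/esym; exact: powm_box.
- move=> k; have -> : m setT = \prod_(i < n) mu setT.
    rewrite -(mE (fun=> setT))//; congr (m _); exact/seteqP.
  rewrite big_const_ord; elim: n {m mE S mS k} => [|n IH] /=.
    by rewrite ltry.
  by rewrite lte_mul_pinfty// ge0_fin_numE.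
Qed.

End powm_unique.

(** * The density of the standard Gaussian measure *)

Section gaussian_density.
Context (R : realType).
Local Open Scope ereal_scope.
Local Notation leb := (@lebesgue_measure R).
Local Notation gauss := (@normal_prob R 0 1).

(** The normal density is almost everywhere the Radon-Nikodym derivative of the
    normal measure, for which the change of measure formula holds. *)
Lemma ge0_integral_normal_prob (m s : R) (f : R -> \bar R) :
  measurable_fun setT f -> (forall x, 0 <= f x) ->
  \int[normal_prob m s]_x f x = \int[leb]_x (f x * (normal_pdf m s x)%:E).
Proof.
move=> mf f0.
rewrite -(Radon_Nikodym_SigmaFinite.change_of_variables
  (normal_prob_dominates m s))//.
apply: ae_eq_integral => //.
- apply: emeasurable_funM => //; apply: (measurable_int leb).
  by apply: Radon_Nikodym_SigmaFinite.f_integrable; exact: normal_prob_dominates.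
- apply: emeasurable_funM => //; apply/measurable_EFinP.
  exact: measurable_normal_pdf.
- apply: ae_eqe_mul2l; apply: integral_ae_eq => //.
  + apply: Radon_Nikodym_SigmaFinite.f_integrable.
    exact: normal_prob_dominates.
  + by apply/measurable_EFinP; exact: measurable_normal_pdf.
  + move=> E _ mE.
    rewrite -Radon_Nikodym_SigmaFinite.f_integral//.
    exact: normal_prob_dominates.
Qed.

Definition gauss_pdf n (x : n.-tuple R) : R :=
  (\prod_(i < n) normal_pdf 0 1 (tnth x i))%R.

Lemma gauss_pdf_ge0 n (x : n.-tuple R) : (0 <= gauss_pdf x)%R.
Proof. by apply: prodr_ge0 => i _; exact: normal_pdf_ge0. Qed.

Lemma measurable_gauss_pdf n : measurable_fun setT (@gauss_pdf n).
Proof.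
apply: measurable_prod => i _.
apply: measurableT_comp; first exact: measurable_normal_pdf.
exact: measurable_tnth.
Qed.

Lemma ge0_integral_powm_gauss n (f : n.-tuple R -> \bar R) :
  measurable_fun [set: n.-tuple R] f -> (forall x, 0 <= f x) ->
  \int[powm gauss n]_x f x = \int[powm leb n]_x (f x * (gauss_pdf x)%:E).
Proof.
elim: n f => [|n IH] f mf f0.
  rewrite !ge0_integral_powm0//.
    by rewrite /gauss_pdf big_ord0 mule1.
  apply: emeasurable_funM => //; apply/measurable_EFinP.
  exact: measurable_gauss_pdf.
have mfc : measurable_fun [set: R * n.-tuple R] (fun p => f [tuple of p.1 :: p.2]).
  by apply: measurableT_comp => //; exact: measurable_tcons.
have mfg : measurable_fun [set: n.+1.-tuple R] (fun x => f x * (gauss_pdf x)%:E).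
  apply: emeasurable_funM => //; apply/measurable_EFinP.
  exact: measurable_gauss_pdf.
rewrite !ge0_integral_powmS//; last first.
  by move=> x; rewrite mule_ge0// lee_fin gauss_pdf_ge0.
rewrite ge0_integral_normal_prob; last 2 first.
- have := @measurable_fun_fubini_tonelli_F _ _ _ _ R (powm gauss n) _ mfc.
  by apply=> p.
- by move=> a; apply: integral_ge0.
apply: eq_integral => a _.
rewrite IH//; last exact: (measurableT_comp mfc (pair1_measurable a)).
rewrite muleC -ge0_integralZl//; last 3 first.
- apply: emeasurable_funM; last first.
    by apply/measurable_EFinP; exact: measurable_gauss_pdf.
  exact: (measurableT_comp mfc (pair1_measurable a)).
- by move=> x _; rewrite mule_ge0// lee_fin gauss_pdf_ge0.
- by rewrite lee_fin normal_pdf_ge0.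
apply: eq_integral => x _.
rewrite /gauss_pdf big_ord_recl tnth0 EFinM muleCA; congr (_ * (_ * _)).
by congr (_%:E); apply: eq_bigr => i _; rewrite tnthS.
Qed.

End gaussian_density.

(** * Linear substitutions in Lebesgue measure on R^n *)

Section row_coordinates.
Context (R : realType).

(** Integrals run over tuples, which carry the product sigma-algebra, while
    linear algebra is done with row vectors: functions on R^n are written
    [fun x => f (rowt x)] with [f] defined on row vectors. *)
Definition rowt n (x : n.-tuple R) : 'rV[R]_n := \row_i tnth x i.

Lemma rowt_cons n (a : R) (x : n.-tuple R) :
  rowt [tuple of a :: x] = row_mx a%:M (rowt x) :> 'rV_(1 + n).
Proof.
apply/rowP => i; case: (@split_ordP 1 n i) => j ->.
  by rewrite row_mxEl ord1 !mxE eqxx mulr1n.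
rewrite row_mxEr !mxE (_ : rshift 1 j = lift ord0 j); first exact: tnthS.
exact/val_inj.
Qed.

Lemma row_mx_affine n (a k a' b : R) (x x' y : 'rV[R]_n) :
  row_mx a%:M x + k *: row_mx a'%:M x' + row_mx b%:M y =
  row_mx (a + k * a' + b)%:M (x + k *: x' + y) :> 'rV_(1 + n).
Proof.
by rewrite scale_row_mx !add_row_mx scale_scalar_mx -!raddfD.
Qed.

Section measurable_rows.
Context d (T : measurableType d).

Definition measurable_row n (g : T -> 'rV[R]_n) :=
  forall i, measurable_fun setT (fun t => g t 0 i).

Lemma measurable_row_cst n (v : 'rV[R]_n) : measurable_row (fun=> v).
Proof. by move=> i; exact: measurable_cst. Qed.

Lemma measurable_rowD n (g h : T -> 'rV[R]_n) :
  measurable_row g -> measurable_row h -> measurable_row (fun t => g t + h t).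
Proof.
move=> mg mh i; under eq_fun do rewrite mxE.
exact: measurable_funD.
Qed.

Lemma measurable_rowZ n (k : T -> R) (g : T -> 'rV[R]_n) :
  measurable_fun setT k -> measurable_row g ->
  measurable_row (fun t => k t *: g t).
Proof.
move=> mk mg i; under eq_fun do rewrite mxE.
exact: measurable_funM.
Qed.

Lemma measurable_row_mulmx n m (g : T -> 'rV[R]_n) (M : 'M[R]_(n, m)) :
  measurable_row g -> measurable_row (fun t => g t *m M).
Proof.
move=> mg i; under eq_fun do rewrite mxE.
by apply: measurable_sum => j; apply: measurable_funM => //; exact: mg.
Qed.

Lemma measurable_row_mx1 n (k : T -> R) (g : T -> 'rV[R]_n) :
  measurable_fun setT k -> measurable_row g ->
  measurable_row (fun t => row_mx (k t)%:M (g t) : 'rV_(1 + n)).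
Proof.
move=> mk mg i; case: (@split_ordP 1 n i) => j ->.
  under eq_fun do rewrite row_mxEl ord1 mxE eqxx mulr1n.
  exact: mk.
under eq_fun do rewrite row_mxEr.
exact: mg.
Qed.

End measurable_rows.

Lemma measurable_rowt n : measurable_row (@rowt n).
Proof. by move=> i; under eq_fun do rewrite mxE; exact: measurable_tnth. Qed.

Lemma measurable_comp_row d (T : measurableType d) d' (U : measurableType d')
    n (f : 'rV[R]_n -> U) (g : T -> 'rV[R]_n) :
  measurable_fun setT (fun x : n.-tuple R => f (rowt x)) -> measurable_row g ->
  measurable_fun setT (fun t => f (g t)).
Proof.
move=> mf mg.
rewrite (_ : (fun t => _) =
  (fun x => f (rowt x)) \o (fun t => [tuple g t 0 i | i < n])).
  apply: measurableT_comp => //; apply/measurable_fun_tnthP => i.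
  rewrite (_ : _ \o _ = fun t => g t 0 i)//.
  by apply/funext => t /=; rewrite tnth_mktuple.
apply/funext => t /=; congr f; apply/rowP => i.
by rewrite mxE tnth_mktuple.
Qed.

End row_coordinates.

Lemma dot_ge0 (R : realType) n (v : 'rV[R]_n) : 0 <= (v *m v^T) 0 0.
Proof.
rewrite !mxE; apply: sumr_ge0 => i _; rewrite mxE -expr2.
exact: sqr_ge0.
Qed.

Lemma dot_eq0 (R : realType) n (v : 'rV[R]_n) : (v *m v^T) 0 0 = 0 -> v = 0.
Proof.
rewrite mxE => v0; apply/rowP => j; rewrite mxE.
apply/eqP; rewrite -sqrf_eq0 expr2.
have := @psumr_eq0P _ _ xpredT (fun j => v 0 j * v^T j 0) _ v0 j isT.
by rewrite mxE => -> // i _; rewrite mxE -expr2; exact: sqr_ge0.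
Qed.

Section linear_substitution.
Context (R : realType).
Local Open Scope ereal_scope.
Local Notation leb := (@lebesgue_measure R).

(** The two sides define measures that agree on half-open intervals. *)
Lemma ge0_integral_affine (a b : R) (f : R -> \bar R) :
  (0 < a)%R -> measurable_fun setT f -> (forall x, 0 <= f x) ->
  a%:E * \int[leb]_x f (a * x + b)%R = \int[leb]_x f x.
Proof.
move=> a0 mf f0.
pose h (x : measurableTypeR R) : measurableTypeR R := (a * x + b)%R.
have mh : measurable_fun setT h by exact: measurable_funD.
pose nna : {nonneg R} := NngNum (ltW a0).
(* The structure of measure of a pushforward takes a proof of measurability as
   an argument. *)
pose m' : {measure set (measurableTypeR R) -> \bar R} :=
  mscale nna (pushforward leb h).
pose m := m' mh.
have lm A : measurable A -> leb A = m A.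
  apply: lebesgue_measure_unique => //= _ [[u v]] _ <-.
  rewrite /m /m' /mscale /= /pushforward.
  rewrite (_ : _ @^-1` _ = `]((u - b) / a)%R, ((v - b) / a)%R]%classic); last first.
    apply/seteqP; split => x /=; rewrite !in_itv/= /h.
      by rewrite ltr_pdivrMr// ler_pdivlMr// ltrBlDr lerBrDr mulrC.
    by rewrite ltr_pdivrMr// ler_pdivlMr// ltrBlDr lerBrDr mulrC.
  rewrite !lebesgue_measure_itv/= !lte_fin ltr_pM2r ?invr_gt0// ltrBDr subrK.
  case: ifPn => _; rewrite ?mule0//.
  by rewrite -!EFinD -EFinM -mulrBl mulrC divfK ?gt_eqF// opprB addrA subrK.
transitivity (\int[m]_x f x).
  rewrite ge0_integral_mscale//; congr (_ * _).
  by rewrite ge0_integral_pushforward.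
by apply: eq_measure_integral => A mA _; apply/esym/lm.
Qed.

(** The Jacobian of x + c (x.e) e is 1 + c |e|^2.  The proof is one step of
    Gaussian elimination followed by an induction on the dimension.  With
    e = (e0, e1) and A = 1 + c e0^2, the first coordinate z of the image is an
    affine function of slope A of the first coordinate of x, and, for fixed z,
    the other coordinates undergo the map of the same kind given by e1 and
    c / A, up to a translation that depends on z.  Hence the translation b and
    the arbitrary norm of e, which the induction requires.  Negative values of c
    occur for contractions. *)
Lemma ge0_integral_rank1 n (e b : 'rV[R]_n) (c : R) (f : 'rV[R]_n -> \bar R) :
  (0 < 1 + c * (e *m e^T) 0 0)%R ->
  measurable_fun setT (fun x : n.-tuple R => f (rowt x)) ->
  (forall x, 0 <= f x) ->
  (1 + c * (e *m e^T) 0 0)%:E *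
    \int[powm leb n]_x f (rowt x + (c * (rowt x *m e^T) 0 0) *: e + b)%R =
  \int[powm leb n]_x f (rowt x).
Proof.
elim: n e b c f => [|n IH] e b c f.
  move=> _ mf f0; rewrite !ge0_integral_powm0//; last first.
    apply: (measurable_comp_row (f := f)) => //.
    by move=> i; case: i.
  by rewrite !mxE big_ord0 mulr0 addr0 mul1e; congr f; apply/rowP => -[].
set s := (1 + _)%R; move=> s0 mf f0.
pose e0 : R := e ord0 ord0; pose e1 : 'rV_n := rsubmx (e : 'rV_(1 + n)).
pose b0 : R := b ord0 ord0; pose b1 : 'rV_n := rsubmx (b : 'rV_(1 + n)).
have eE : e = row_mx e0%:M e1 :> 'rV_(1 + n).
  rewrite -[LHS](hsubmxK (m := 1) (n1 := 1)); congr row_mx.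
  by rewrite [LHS]mx11_scalar !mxE; congr (e _ _)%:M; exact/val_inj.
have bE : b = row_mx b0%:M b1 :> 'rV_(1 + n).
  rewrite -[LHS](hsubmxK (m := 1) (n1 := 1)); congr row_mx.
  by rewrite [LHS]mx11_scalar !mxE; congr (b _ _)%:M; exact/val_inj.
have dotE (v w : 'rV[R]_(1 + n)) a v' a' w' :
    v = row_mx a%:M v' -> w = row_mx a'%:M w' ->
    ((v *m w^T) 0 0 = a * a' + (v' *m w'^T) 0 0)%R.
  move=> -> ->; rewrite tr_row_mx mul_row_col tr_scalar_mx -scalar_mxM !mxE.
  by rewrite eqxx mulr1n.
pose A := (1 + c * e0 ^+ 2)%R.
have sE : s = (A + c * (e1 *m e1^T) 0 0)%R.
  by rewrite /s (dotE e e _ _ _ _ eE eE) mulrDr addrA.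
(* A lies between 1 and s, in an order that depends on the sign of c. *)
have A0 : (0 < A)%R.
  have [c0|c0] := leP 0%R c.
    by rewrite ltr_pwDl// mulr_ge0// sqr_ge0.
  rewrite (_ : A = s - c * (e1 *m e1^T) 0 0)%R; last by rewrite sE addrK.
  by rewrite -mulNr ltr_wpDr// mulr_ge0 ?dot_ge0// oppr_ge0 ltW.
(* The image of (a, y) is described by F at the point (z, y), where
   z = A a + sh y is its first coordinate. *)
pose sh (x : n.-tuple R) := (c * (rowt x *m e1^T) 0 0 * e0 + b0)%R.
pose F (p : R * n.-tuple R) := f (row_mx p.1%:M (rowt p.2 +
  (c / A * (rowt p.2 *m e1^T) 0 0) *: e1 +
  ((c * e0 * (p.1 - b0) / A) *: e1 + b1)))%R.
have msnd : measurable_row (fun p : R * n.-tuple R => rowt p.2).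
  by move=> i; exact: (measurableT_comp (measurable_rowt i)).
have mdot : measurable_fun [set: R * n.-tuple R]
    (fun p => (rowt p.2 *m e1^T) 0 0)%R.
  exact: (measurable_row_mulmx e1^T msnd).
have mF : measurable_fun [set: R * n.-tuple R] F.
  apply: (measurable_comp_row (f := f)) => //.
  apply: measurable_row_mx1 => //; apply: measurable_rowD.
    apply: measurable_rowD => //; apply: measurable_rowZ.
      exact: measurable_funM.
    exact: measurable_row_cst.
  apply: measurable_rowD; last exact: measurable_row_cst.
  apply: measurable_rowZ; last exact: measurable_row_cst.
  apply: measurable_funM => //; apply: measurable_funM => //.
  exact: measurable_funB.
have mG : measurable_fun [set: R * n.-tuple R]
    (fun p => F ((A * p.1 + sh p.2)%R, p.2)).
  apply: (measurableT_comp mF); apply/measurable_fun_pairP; split => /=; last first.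
    exact: measurable_snd.
  apply: measurable_funD; first exact: measurable_funM.
  apply: measurable_funD => //; apply: measurable_funM => //.
  exact: measurable_funM.
have fub (G : R * n.-tuple R -> \bar R) :
    measurable_fun [set: R * n.-tuple R] G -> (forall p, 0 <= G p) ->
    \int[leb]_a \int[powm leb n]_y G (a, y) =
    \int[powm leb n]_y \int[leb]_a G (a, y).
  move=> mG' G0.
  exact: (@fubini_tonelli _ _ _ _ R leb (powm leb n) G mG' G0).
have F0 p : 0 <= F p by exact: f0.
rewrite (ge0_integral_powmS leb (f := fun x => f (rowt x)))//.
rewrite (ge0_integral_powmS leb (f := fun x =>
  f (rowt x + (c * (rowt x *m e^T) 0 0) *: e + b)%R))//; last first.
  apply: (measurable_comp_row (f := f)) => //.
  apply: measurable_rowD; last exact: measurable_row_cst.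
  apply: measurable_rowD; first exact: measurable_rowt.
  apply: measurable_rowZ; last exact: measurable_row_cst.
  apply: measurable_funM => //.
  exact: (measurable_row_mulmx e^T (@measurable_rowt _ _)).
under eq_integral => a _.
  under eq_integral => y _.
    rewrite (_ : f _ = F ((A * a + sh y)%R, y)); last first.
      rewrite /F /sh /= rowt_cons (dotE _ _ _ _ _ _ erefl eE) eE bE.
      set dd := (rowt y *m e1^T) 0%R 0%R.
      transitivity (f (row_mx (a + c * (a * e0 + dd) * e0 + b0)%:M
          (rowt y + (c * (a * e0 + dd)) *: e1 + b1) : 'rV_(1 + n)))%R.
        by congr f; exact: row_mx_affine.
      congr (f (@row_mx R 1 1 n _ _)); first by congr (_%:M); rewrite /A; ring.
      have -> : (c * (a * e0 + dd) =
          c / A * dd + c * e0 * (A * a + (c * dd * e0 + b0) - b0) / A)%R.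
        by rewrite /A; field; exact: lt0r_neq0.
      by rewrite scalerDl !addrA.
    over.
  over.
rewrite (fub (fun p => F ((A * p.1 + sh p.2)%R, p.2)))//=.
have -> : s = (s / A * A)%R by rewrite divfK// gt_eqF.
rewrite EFinM -muleA -ge0_integralZl//; last 3 first.
- exact: (@measurable_fun_fubini_tonelli_G _ _ _ _ R leb _ mG).
- by move=> y _; apply: integral_ge0.
- by rewrite lee_fin ltW.
under eq_integral => y _.
  rewrite (ge0_integral_affine (sh y) (f := fun z => F (z, y)))//.
    over.
  exact: (measurableT_comp mF (pair2_measurable y)).
rewrite -(fub F)//=.
rewrite -ge0_integralZl//; last 3 first.
- exact: (@measurable_fun_fubini_tonelli_F _ _ _ _ R (powm leb n) _ mF).
- by move=> a _; apply: integral_ge0.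
- by rewrite lee_fin divr_ge0// ltW.
apply: eq_integral => a _.
have sAE : (s / A = 1 + c / A * (e1 *m e1^T) 0 0)%R.
  by rewrite sE mulrDl divff ?gt_eqF// mulrAC.
rewrite sAE /F /= (IH _ _ _ (fun v => f (row_mx a%:M v : 'rV_(1 + n))))//.
- by apply: eq_integral => y _; rewrite rowt_cons.
- by rewrite -sAE divr_gt0.
- apply: (measurable_comp_row (f := f)) => //.
  apply: measurable_row_mx1; first exact: measurable_cst.
  exact: measurable_rowt.
Qed.

(** If E has orthonormal rows, x E^T E is the orthogonal projection of x onto
    their span, and the dilation by t of this span is the composite of the
    dilations along the rows, each of them of Jacobian t. *)
Lemma ge0_integral_orthonormal r n (E : 'M[R]_(r, n)) (t : R)
    (f : 'rV[R]_n -> \bar R) :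
  (0 < t)%R -> E *m E^T = 1%:M ->
  measurable_fun setT (fun x : n.-tuple R => f (rowt x)) ->
  (forall x, 0 <= f x) ->
  (t ^+ r)%:E *
    \int[powm leb n]_x f (rowt x + (t - 1) *: (rowt x *m E^T *m E))%R =
  \int[powm leb n]_x f (rowt x).
Proof.
move=> t0; elim: r E f => [|r IH] E f.
  move=> _ mf f0; rewrite expr0 mul1e; apply: eq_integral => x _.
  by rewrite (thinmx0 (_ *m E^T)) mul0mx scaler0 addr0.
move=> EE mf f0.
pose e : 'rV[R]_n := usubmx (E : 'M[R]_(1 + r, n)).
pose E' : 'M[R]_(r, n) := dsubmx (E : 'M[R]_(1 + r, n)).
have EE' : E = col_mx e E' :> 'M[R]_(1 + r, n) by rewrite vsubmxK.
have : block_mx (e *m e^T) (e *m E'^T) (E' *m e^T) (E' *m E'^T) =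
    block_mx (1%:M : 'M[R]_1) 0 0 (1%:M : 'M[R]_r).
  rewrite -mul_col_row -tr_col_mx -EE' -scalar_mx_block; exact: EE.
move=> /eq_block_mx[ee eE' E'e E'E'].
have sub_E x : (x *m E^T *m E = x *m e^T *m e + x *m E'^T *m E')%R.
  have -> : (x *m E^T *m E = x *m (col_mx e E')^T *m col_mx e E')%R.
    by rewrite -EE'.
  by rewrite tr_col_mx mul_mx_row mul_row_col.
have mf' : measurable_fun setT (fun x : n.-tuple R =>
    f (rowt x + (t - 1) *: (rowt x *m E'^T *m E'))%R).
  apply: (measurable_comp_row (f := f)) => //.
  apply: measurable_rowD; first exact: measurable_rowt.
  apply: measurable_rowZ; first exact: measurable_cst.
  do 2! apply: measurable_row_mulmx; exact: measurable_rowt.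
rewrite -(IH E' f)// exprSr EFinM -muleA; congr (_ * _).
have c1 : (1 + (t - 1) * (e *m e^T) 0 0 = t)%R.
  by rewrite ee mxE eqxx mulr1 subrKC.
rewrite -(ge0_integral_rank1 (e := e) 0%R (c := (t - 1)%R)
  (f := fun v => f (v + (t - 1) *: (v *m E'^T *m E'))%R))//; last by rewrite c1.
rewrite c1; congr (_ * _); apply: eq_integral => x _; congr f.
rewrite addr0 sub_E !mulmxDl -!scalemxAl eE' mul0mx scaler0 addr0.
rewrite scalerDr addrA; congr (_ + _ + _)%R.
by rewrite [X in X *m e]mx11_scalar mul_scalar_mx scalerA.
Qed.

End linear_substitution.

(** * The Gamma mass of a window with given endpoint ratio *)

Section gamma_window.
Context (R : realType).
Local Open Scope ereal_scope.
Local Notation leb := (@lebesgue_measure R).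
Implicit Types (alpha eps c k : R).

Lemma gamma_integrand_ge0 alpha (s : R) : (0 <= gamma_integrand alpha s)%R.
Proof. by rewrite mulr_ge0 ?powR_ge0 ?expR_ge0. Qed.

Lemma measurable_gamma_integrand alpha :
  measurable_fun setT (@gamma_integrand R alpha).
Proof.
apply: measurable_funM; first exact: measurable_powR.
by apply: measurableT_comp => //; exact: measurable_funN.
Qed.

Lemma measurable_gamma_integrandE alpha (D : set R) :
  measurable_fun D (EFin \o @gamma_integrand R alpha).
Proof.
apply/measurable_EFinP; apply: measurable_funTS.
exact: measurable_gamma_integrand.
Qed.

(** After dilation by k, the dependence of the Gamma integrand on k is confined
    to the factor exp(alpha ln k - k z), so that two dilations of an interval
    can be compared pointwise, see [le_gamma_mass_scale]. *)
Lemma gamma_integrand_scale alpha k (z : R) : (0 < k)%R -> (0 < z)%R ->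
  (k * gamma_integrand alpha (k * z) =
   expR (alpha * ln k - k * z) * z `^ (alpha - 1))%R.
Proof.
move=> k0 z0; rewrite /gamma_integrand powRM ?ltW//.
have -> : (k `^ (alpha - 1) = expR (alpha * ln k) / k)%R.
  by rewrite /powR gt_eqF// mulrBl mul1r expRB lnK.
rewrite expRB expRN; field.
by rewrite !gt_eqF ?expR_gt0.
Qed.

(** Half-open intervals are concatenated without overlap. *)
Definition gamma_mass alpha a b :=
  \int[leb]_(s in `]a, b]) (gamma_integrand alpha s)%:E.

Lemma gamma_mass_cat alpha (a b c : R) : (a <= b)%R -> (b <= c)%R ->
  gamma_mass alpha a c = gamma_mass alpha a b + gamma_mass alpha b c.
Proof.
move=> ab bc; rewrite /gamma_mass -ge0_integral_setU//=.
- by congr integral; rewrite -itv_bndbnd_setU// bnd_simp.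
- exact: measurable_gamma_integrandE.
- by move=> x _; rewrite lee_fin gamma_integrand_ge0.
- apply/disj_setPS => x [/=]; rewrite !in_itv/= => /andP[_ xb] /andP[bx _].
  by move: (lt_le_trans bx xb); rewrite ltxx.
Qed.

Lemma ge0_integral_dilation k (D D' : set R) (f : R -> \bar R) :
  (0 < k)%R -> measurable D -> (forall z, D' z <-> D (k * z)%R) ->
  measurable_fun setT f -> (forall x, 0 <= f x) ->
  \int[leb]_(x in D) f x = k%:E * \int[leb]_(z in D') f (k * z)%R.
Proof.
move=> k0 mD DE mf f0.
rewrite [in LHS]integral_mkcond -(ge0_integral_affine 0 k0); last 2 first.
- by apply/(measurable_restrictT _ _).1 => //; exact: measurable_funTS.
- by move=> x; apply: erestrict_ge0.
congr (_ * _); rewrite [RHS]integral_mkcond; apply: eq_integral => z _.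
rewrite addr0 !patchE.
have -> // : ((k * z)%R \in D) = (z \in D').
by apply/idP/idP => /set_mem/DE/mem_set.
Qed.

Lemma gamma_mass_scale alpha k (a b : R) : (0 < k)%R ->
  gamma_mass alpha (k * a)%R (k * b)%R =
  \int[leb]_(z in `]a, b]) (k * gamma_integrand alpha (k * z))%:E.
Proof.
move=> k0; rewrite /gamma_mass.
rewrite (@ge0_integral_dilation k _ `]a, b]%classic)//.
- rewrite -ge0_integralZl//.
  + apply/measurable_EFinP; apply: measurable_funTS.
    apply: measurableT_comp; first exact: measurable_gamma_integrand.
    exact: measurable_funM.
  + by move=> x _; rewrite lee_fin gamma_integrand_ge0.
  + by rewrite lee_fin ltW.
- by move=> z; rewrite /= !in_itv/= !ltr_pM2l// !ler_pM2l.
- exact: measurable_gamma_integrandE.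
- by move=> x; rewrite lee_fin gamma_integrand_ge0.
Qed.

Lemma le_gamma_mass_scale alpha k1 k2 (a b : R) : (0 < k1)%R -> (0 < k2)%R ->
  (forall z, `]a, b]%classic z ->
    0 < z /\ alpha * ln k1 - k1 * z <= alpha * ln k2 - k2 * z)%R ->
  gamma_mass alpha (k1 * a)%R (k1 * b)%R <= gamma_mass alpha (k2 * a)%R (k2 * b)%R.
Proof.
move=> k10 k20 le12.
have mscale k (D : set R) :
    measurable_fun D (fun z => (k * gamma_integrand alpha (k * z))%:E).
  apply/measurable_EFinP; apply: measurable_funTS; apply: measurable_funM => //.
  apply: measurableT_comp; first exact: measurable_gamma_integrand.
  exact: measurable_funM.
rewrite !gamma_mass_scale//.
apply: ge0_le_integral => //.
- by move=> z _; rewrite lee_fin mulr_ge0 ?gamma_integrand_ge0 ?ltW.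
- exact: mscale.
- exact: mscale.
move=> z /le12[z0 lez]; rewrite lee_fin !gamma_integrand_scale//.
by rewrite ler_wpM2r ?powR_ge0// ler_expR.
Qed.

Lemma tauE eps : (0 < eps)%R -> (eps < 1)%R ->
  (tau eps * (2 * eps) = ln (1 + eps) - ln (1 - eps))%R.
Proof. by move=> e0 e1; rewrite /tau divfK// mulf_neq0 ?gt_eqF// pnatr_eq0. Qed.

Lemma tau_gt0 eps : (0 < eps)%R -> (eps < 1)%R -> (0 < tau eps)%R.
Proof.
move=> e0 e1; rewrite divr_gt0 ?mulr_gt0// subr_gt0 ltr_ln ?posrE; lra.
Qed.

(** Moving the centre of the window from c to m = tau(eps) alpha replaces the
    mass between the two lower endpoints by the mass between the two upper
    endpoints.  Both are dilations, by 1 - eps and 1 + eps, of the interval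
    between c and m, and the comparison of their integrands at z amounts to
    the comparison of z with m.  The mass common to the two windows is
    cancelled, which is why the total mass has to be finite. *)
Lemma gamma_mass_window_max alpha eps c : (0 < alpha)%R ->
  (0 < eps)%R -> (eps < 1)%R -> (0 < c)%R ->
  \int[leb]_(s in `[0%R, +oo[) (gamma_integrand alpha s)%:E < +oo ->
  gamma_mass alpha ((1 - eps) * c)%R ((1 + eps) * c)%R <=
  gamma_mass alpha ((1 - eps) * (tau eps * alpha))%R
                   ((1 + eps) * (tau eps * alpha))%R.
Proof.
move=> alpha0 e0 e1 c0 Goo; set m := (tau eps * alpha)%R.
have m0 : (0 < m)%R by rewrite mulr_gt0// tau_gt0.
have l0 : (0 < 1 - eps)%R by lra.
have u0 : (0 < 1 + eps)%R by lra.
have mass_fin a b : (0 <= a)%R -> gamma_mass alpha a b \is a fin_num.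
  move=> a0; rewrite ge0_fin_numE; last first.
    by apply: integral_ge0 => x _; rewrite lee_fin gamma_integrand_ge0.
  apply: le_lt_trans Goo; apply: ge0_subset_integral => //.
  - exact: measurable_gamma_integrandE.
  - by move=> x _; rewrite lee_fin gamma_integrand_ge0.
  - by move=> x /=; rewrite !in_itv/= andbT => /andP[/ltW/(le_trans a0)].
have mE : (m * (2 * eps) = alpha * ln (1 + eps) - alpha * ln (1 - eps))%R.
  by rewrite /m mulrAC tauE// mulrC mulrBr.
have lu x : (0 < x)%R -> ((1 - eps) * x <= (1 + eps) * x)%R.
  by move=> x0; rewrite ler_pM2r//; lra.
have [cm|mc] := leP c m.
- rewrite -(leeD2rE (x := gamma_mass alpha ((1 + eps) * c)%R ((1 + eps) * m)%R)).
    rewrite -gamma_mass_cat ?lu ?ler_pM2l//.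
    rewrite (@gamma_mass_cat alpha _ ((1 - eps) * m)%R) ?lu ?ler_pM2l//.
    rewrite addeC leeD2l//; apply: le_gamma_mass_scale => // z /=.
    rewrite in_itv/= => /andP[cz zm]; split; first lra.
    nra.
  by rewrite mass_fin// mulr_ge0 ?ltW.
- rewrite -(leeD2rE (x := gamma_mass alpha ((1 - eps) * m)%R ((1 - eps) * c)%R)).
    rewrite [leLHS]addeC -gamma_mass_cat ?lu ?ler_pM2l ?(ltW mc)//.
    rewrite (@gamma_mass_cat alpha _ ((1 + eps) * m)%R) ?lu ?ler_pM2l ?(ltW mc)//.
    rewrite leeD2l//; apply: le_gamma_mass_scale => // z /=.
    rewrite in_itv/= => /andP[mz zc]; split; first lra.
    nra.
  by rewrite mass_fin// mulr_ge0 ?ltW.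
Qed.

Lemma Gamma_split alpha (a b : R) : (0 <= a)%R -> (a <= b)%R ->
  \int[leb]_(s in `[0%R, +oo[) (gamma_integrand alpha s)%:E < +oo ->
  Gamma alpha = (lower_gamma alpha a + fine (gamma_mass alpha a b) +
                 upper_gamma alpha b)%R.
Proof.
move=> a0 ab Goo.
have fin (D : set R) : measurable D -> D `<=` `[0%R, +oo[ ->
    \int[leb]_(s in D) (gamma_integrand alpha s)%:E \is a fin_num.
  move=> mD D0; rewrite ge0_fin_numE; last first.
    by apply: integral_ge0 => x _; rewrite lee_fin gamma_integrand_ge0.
  apply: le_lt_trans Goo; apply: ge0_subset_integral => //.
  - exact: measurable_gamma_integrandE.
  - by move=> x _; rewrite lee_fin gamma_integrand_ge0.
have split (i j k : itv_bound R) : (i <= j)%O -> (j <= k)%O ->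
    \int[leb]_(s in [set` Interval i k]) (gamma_integrand alpha s)%:E =
    \int[leb]_(s in [set` Interval i j]) (gamma_integrand alpha s)%:E +
    \int[leb]_(s in [set` Interval j k]) (gamma_integrand alpha s)%:E.
  move=> ij jk; rewrite -ge0_integral_setU//=.
  - by congr integral; rewrite -itv_bndbnd_setU.
  - exact: measurable_gamma_integrandE.
  - by move=> x _; rewrite lee_fin gamma_integrand_ge0.
  - apply/disj_setPS => x [/=]; rewrite !itv_boundlr => /andP[_ xj] /andP[jx _].
    by have := le_trans xj jx; rewrite bnd_simp ltxx.
rewrite /Gamma /lower_gamma /upper_gamma /Rintegral.
rewrite (split (BLeft 0%R) (BRight a)) ?bnd_simp//.
rewrite (split (BRight a) (BRight b)) ?bnd_simp//.
rewrite -(@integral_itv_obnd_cbnd _ b +oo%O); last first.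
  exact: measurable_gamma_integrandE.
have f1 : \int[leb]_(s in `[0%R, a]) (gamma_integrand alpha s)%:E \is a fin_num.
  by apply: fin => // x /=; rewrite !in_itv/= andbT => /andP[].
have f2 : \int[leb]_(s in `]a, b]) (gamma_integrand alpha s)%:E \is a fin_num.
  by apply: fin => // x /=; rewrite !in_itv/= andbT => /andP[/ltW/(le_trans a0)].
have f3 : \int[leb]_(s in `]b, +oo[) (gamma_integrand alpha s)%:E \is a fin_num.
  apply: fin => // x /=; rewrite !in_itv/= !andbT => /ltW.
  exact/le_trans/(le_trans a0).
by rewrite /gamma_mass -(fineK f1) -(fineK f2) -(fineK f3) /= addrA.
Qed.

End gamma_window.

(** * The quadratic form of the estimator *)

Section quadratic_form.
Context (R : realType).

(** Gram-Schmidt: split off a unit vector v of the row space and proceed with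
    the projection of A onto the orthogonal complement of v, whose rank is
    smaller.  The number of rows of E is identified with the rank only at the
    end, by mutual inclusion of the row spaces. *)
Lemma exists_orthonormal_row_basis m n (A : 'M[R]_(m, n)) :
  exists E : 'M[R]_(\rank A, n), E *m E^T = 1%:M /\ A *m E^T *m E = A.
Proof.
suff [r [E [EE AE EA]]] : exists r, exists E : 'M[R]_(r, n),
    [/\ E *m E^T = 1%:M, A *m E^T *m E = A & (E <= A)%MS].
  have rE : \rank E = r.
    apply/eqP; rewrite eqn_leq rank_leq_row/=.
    by rewrite -{1}(mxrank1 R r) -EE mxrankM_maxl.
  have rA : r = \rank A.
    rewrite -rE; apply/eqP; rewrite eqn_leq mxrankS//=.
    by rewrite -{1}AE mxrankM_maxr.
  by rewrite -rA; exists E.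
have [k] := ubnP (\rank A).
elim: k A => // k IH A; rewrite ltnS => Ak.
have [->|A_neq0] := eqVneq A 0.
  exists 0%N, 0; split; first by rewrite [LHS]flatmx0 [RHS]flatmx0.
    by rewrite !mul0mx.
  exact: sub0mx.
have [u uA u_neq0] : exists2 u : 'rV[R]_n, (u <= A)%MS & u != 0.
  by have /rowV0Pn[u] := A_neq0; exists u.
pose s := (u *m u^T) 0 0.
have s_gt0 : 0 < s.
  rewrite lt_def dot_ge0 andbT; apply: contra u_neq0 => /eqP s0.
  by apply/eqP; exact: dot_eq0.
pose v := (Num.sqrt s)^-1 *: u.
have vv : v *m v^T = 1%:M.
  rewrite /v linearZ/= -scalemxAl -scalemxAr scalerA [u *m u^T]mx11_scalar -/s.
  rewrite scale_scalar_mx -expr2 exprVn sqr_sqrtr ?ltW// mulVf//.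
  exact: lt0r_neq0.
have vA : (v <= A)%MS by exact: scalemx_sub.
pose A' := A - A *m v^T *m v.
have A'v : A' *m v^T = 0 by rewrite mulmxBl -!mulmxA vv mulmx1 subrr.
have A'A : (A' <= A)%MS by rewrite addmx_sub// eqmx_opp mulmx_sub.
have rA' : (\rank A' < \rank A)%N.
  apply: rank_ltmx; rewrite /ltmx A'A /=; apply/negP => AA'.
  have /submxP[D vD] : (v <= A')%MS. by apply: submx_trans vA _.
  move: vv; rewrite {1}vD -mulmxA A'v mulmx0 => /matrixP/(_ 0 0).
  by rewrite !mxE eqxx => /eqP; rewrite eq_sym oner_eq0.
have [r [E [EE A'E EA']]] := IH A' (leq_trans rA' Ak).
have [D ED] := submxP EA'.
have Ev : E *m v^T = 0 by rewrite ED -mulmxA A'v mulmx0.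
have vE : v *m E^T = 0.
  by apply: (can_inj (@trmxK _ _ _)); rewrite trmx_mul trmxK Ev !linear0.
have AE : A *m E^T = A' *m E^T.
  by rewrite mulmxBl -[X in _ - X]mulmxA vE mulmx0 subr0.
exists (1 + r)%N, (col_mx v E); split.
- by rewrite tr_col_mx mul_col_row vv EE Ev vE -scalar_mx_block.
- by rewrite tr_col_mx mul_mx_row mul_row_col AE A'E /A' addrC subrK.
- by rewrite col_mx_sub vA (submx_trans EA' A'A).
Qed.

(** A semidefinite matrix with zero trace has zero diagonal, and then its value
    at t e_i + e_j, nonnegative and affine in t, is constant. *)
Lemma psdmx_trace_gt0 n (A : 'M[R]_n) :
  A^T = A -> psdmx A -> (0 < \rank A)%N -> 0 < \tr A.
Proof.
move=> symA psdA; apply: contraTT; rewrite -leNgt -leqNgt leqn0 mxrank_eq0 => trA.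
have form2 (t : R) i j : 0 <= t ^+ 2 * A i i + 2 * t * A i j + A j j.
  have deltaE k l : (delta_mx k 0)^T *m A *m delta_mx l (0 : 'I_1) = (A k l)%:M.
    by rewrite trmx_delta -rowE -colE [LHS]mx11_scalar !mxE.
  have := psdA (t *: delta_mx i 0 + delta_mx j 0).
  rewrite [(_ + _)^T]linearD/= [(_ *: _)^T]linearZ/= !mulmxDl !mulmxDr.
  rewrite -!scalemxAl -!scalemxAr !deltaE !mxE eqxx !mulr1n.
  have -> : A j i = A i j by rewrite -{1}symA mxE.
  by congr (0 <= _); ring.
have diag0 i : 0 <= A i i.
  by have := form2 0 i i; rewrite expr0n/= !(mul0r, mulr0, add0r).
have diagE i : A i i = 0.
  have tr0 : \tr A = 0 by apply/eqP; rewrite eq_le trA sumr_ge0.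
  exact: (@psumr_eq0P _ _ xpredT (fun i => A i i) (fun i _ => diag0 i) tr0 i isT).
apply/eqP/matrixP => i j; rewrite mxE; apply/eqP; rewrite -sqrf_eq0.
have := form2 (- A i j) i j; rewrite !diagE; have := sqr_ge0 (A i j); nra.
Qed.

Lemma row_quad_form N n (A : 'M[R]_n) (V : 'M[R]_(N, n)) i :
  (row i V *m A *m (row i V)^T) 0 0 = (V *m A *m V^T) i i.
Proof. by rewrite -row_mul !mxE; apply: eq_bigr => k _; rewrite !mxE. Qed.

(** The estimator as a function of all N n components of the sample, listed
    row by row. *)
Definition rowform N n (A : 'M[R]_n) (v : 'rV[R]_(N * n)) : R :=
  N%:R^-1 * \tr (vec_mx v *m A *m (vec_mx v)^T).

Lemma rowform_ge0 N n (A : 'M[R]_n) (v : 'rV[R]_(N * n)) :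
  psdmx A -> 0 <= rowform A v.
Proof.
move=> psdA; rewrite mulr_ge0 ?invr_ge0//; apply: sumr_ge0 => i _.
by have := psdA (row i (vec_mx v))^T; rewrite trmxK row_quad_form.
Qed.

Lemma rowform_gaussian_trace N n (A : 'M[R]_n) (W : 'M[R]_(N, n)) :
  gaussian_trace (fun i => \col_j W i j) A = rowform A (mxvec W).
Proof.
rewrite /rowform mxvecK /gaussian_trace; congr (_ * _).
apply: eq_bigr => i _.
have -> : \col_j W i j = (row i W)^T by apply/colP => j; rewrite !mxE.
by rewrite trmxK row_quad_form.
Qed.

(** E' consists of N copies of E, one for each sample vector.  The form only
    depends on the components along the rows of E, so dilating these by t
    multiplies it by t^2. *)
Lemma rowform_dilation N n r (A : 'M[R]_n) (E : 'M[R]_(r, n)) :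
  A^T = A -> E *m E^T = 1%:M -> A *m E^T *m E = A ->
  exists2 E' : 'M[R]_(N * r, N * n), E' *m E'^T = 1%:M &
    forall t v,
      rowform A (v + (t - 1) *: (v *m E'^T *m E')) = t ^+ 2 * rowform A v.
Proof.
move=> symA EE AE.
pose E' : 'M[R]_(N * r, N * n) := lin_mulmxr E.
have E'T : E'^T = lin_mulmxr E^T.
  apply/matrixP => k l; rewrite mxE.
  case: (mxvec_indexP k) => i j; case: (mxvec_indexP l) => i' j'.
  have deltaM a b c (M : 'M[R]_(b, c)) (i0 i1 : 'I_a) j0 j1 :
      (delta_mx i0 j0 *m M) i1 j1 = (i1 == i0)%:R * M j0 j1.
    rewrite mxE (bigD1 j0)//= big1 => [|h /negPf hj0]; rewrite mxE.
      by rewrite eqxx andbT addr0.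
    by rewrite hj0 andbF mul0r.
  rewrite !mxE /= !mxvecE !vec_mx_delta !deltaM mxE eq_sym.
  by case: eqVneq => // ->.
have E'E : E' *m E'^T = 1%:M.
  apply/row_matrixP => k; rewrite !rowE mulmx1 mulmxA E'T.
  rewrite -[delta_mx _ _]vec_mxK !mul_vec_lin /= -mulmxA EE mulmx1.
  by rewrite vec_mxK.
exists E' => // t v.
rewrite /rowform mulrCA; congr (_ * _).
set V := vec_mx v.
have -> : v *m E'^T *m E' = mxvec (V *m E^T *m E).
  by rewrite E'T -[v]vec_mxK !mul_vec_lin.
have EA : E^T *m E *m A = A.
  by apply: (can_inj (@trmxK _ _ _)); rewrite !trmx_mul trmxK symA mulmxA.
rewrite linearD linearZ/= mxvecK -/V.
have -> : (V + (t - 1) *: (V *m E^T *m E)) *m A = t *: (V *m A).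
  have VEA : V *m E^T *m E *m A = V *m A.
    by rewrite -!mulmxA [E^T *m _]mulmxA EA.
  by rewrite mulmxDl -scalemxAl VEA scalerBl scale1r subrKC.
have -> : t *: (V *m A) *m (V + (t - 1) *: (V *m E^T *m E))^T =
    t ^+ 2 *: (V *m A *m V^T).
  have VAE : V *m A *m (V *m E^T *m E)^T = V *m A *m V^T.
    rewrite !trmx_mul trmxK -!mulmxA; congr (V *m _).
    by rewrite !mulmxA AE.
  rewrite linearD/= linearZ/= -scalemxAl mulmxDr -scalemxAr VAE.
  by rewrite -{1}[V *m A *m V^T]scale1r -scalerDl subrKC scalerA expr2.
by rewrite linearZ.
Qed.

End quadratic_form.

(** * The law of the form as a mixture of Gamma laws *)

Section positive_halfline.
Context (R : realType).
Local Open Scope ereal_scope.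
Local Notation leb := (@lebesgue_measure R).

(** Tonelli's theorem is applied on the whole line, with this factor restricting
    the scale variable to the half-line. *)
Definition pos_ind (s : R) : R := \1_(`]0%R, +oo[%classic) s.

Lemma pos_indE s : pos_ind s = ((0 < s)%R)%:R.
Proof.
by rewrite /pos_ind indicE mem_setE in_itv/= andbT.
Qed.

Lemma pos_ind_ge0 s : (0 <= pos_ind s)%R.
Proof. by rewrite pos_indE. Qed.

Lemma measurable_pos_ind : measurable_fun setT pos_ind.
Proof. exact: measurable_indic. Qed.

Lemma integral_halfline (f : R -> R) :
  \int[leb]_(s in `]0%R, +oo[) (f s)%:E = \int[leb]_s (f s * pos_ind s)%:E.
Proof.
rewrite integral_mkcond; apply: eq_integral => s _.
rewrite patchE pos_indE mem_setE in_itv/= andbT.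
by case: ifP => _; rewrite ?mulr1 ?mulr0.
Qed.

Lemma integral_halfline_exp (k : R) : (0 < k)%R ->
  \int[leb]_s (k * expR (- (k * s)) * pos_ind s)%:E = 1.
Proof.
move=> k0; rewrite -integral_halfline.
rewrite -(integral_exponential_pdf k0) [RHS](_ : _ =
  \int[leb]_(x in `[0%R, +oo[) (k * expR (- (k * x)))%:E).
  apply: integral_itv_obnd_cbnd; apply/measurable_EFinP.
  apply: measurable_funTS; apply: measurable_funM => //.
  by apply: measurableT_comp => //; apply: measurable_funN; exact: measurable_funM.
rewrite [RHS]integral_mkcond; apply: eq_integral => x _.
rewrite /exponential_pdf !patchE; case: ifP => // _.
by rewrite mulNr.
Qed.
End positive_halfline.

Section gamma_mixture.
Context (R : realType).
Local Open Scope ereal_scope.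
Local Notation leb := (@lebesgue_measure R).
Variables (m r : nat) (E : 'M[R]_(r, m)) (q : 'rV[R]_m -> R).
Hypothesis EE : E *m E^T = 1%:M.
Hypothesis mq : measurable_fun setT (fun x : m.-tuple R => q (rowt x)).
Hypothesis q_ge0 : forall v, (0 <= q v)%R.
Hypothesis qE : forall t v, q (v + (t - 1) *: (v *m E^T *m E))%R = (t ^+ 2 * q v)%R.

Local Notation alpha := (r%:R / 2 : R)%R.
Local Notation nrm v := ((v *m v^T) ord0 ord0).

Definition proj_sqnorm (v : 'rV[R]_m) : R :=
  (v *m E^T *m (v *m E^T)^T) ord0 ord0.
Local Notation p := proj_sqnorm.

(** [gauss_pdf] in terms of the Euclidean norm, see [gauss_pdfE]. *)
Definition gauss_dens (v : 'rV[R]_m) : R :=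
  (normal_peak 1 ^+ m * expR (- (v *m v^T) ord0 ord0 / 2))%R.

Lemma gauss_pdfE (x : m.-tuple R) : gauss_pdf x = gauss_dens (rowt x).
Proof.
rewrite /gauss_pdf /gauss_dens normal_pdfE ?oner_neq0//.
rewrite big_split/= big_const_ord iter_mulr_1; congr (_ * _)%R.
rewrite -(big_morph expR (@expRD R) (@expR0 R)); congr expR.
rewrite mxE -sumrN mulr_suml; apply: eq_bigr => i _.
by rewrite !mxE subr0 expr1n expr2.
Qed.

(** The factor of the Gaussian density that depends only on the directions
    orthogonal to the rows of E, times the weight exp(-1/q) / q that results
    from the auxiliary scale variable.  By the convention on inverses, the
    weight is 0 where q = 0. *)
Definition radial_weight (v : 'rV[R]_m) : R :=
  (normal_peak 1 ^+ m * expR (- (nrm v - p v) / 2) *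
   ((q v)^-1 * expR (- (q v)^-1)))%R.

Local Notation weight := radial_weight.

Definition proj_dilation (s : R) (v : 'rV[R]_m) :=
  (v + (Num.sqrt s - 1) *: (v *m E^T *m E))%R.
Local Notation D := proj_dilation.

Lemma sqnorm_proj_dilation s v : (0 <= s)%R ->
  nrm (D s v) = (nrm v - p v + s * p v)%R.
Proof.
move=> s0; rewrite /proj_dilation; set t := Num.sqrt s.
have -> : s = (t ^+ 2)%R by rewrite sqr_sqrtr.
rewrite linearD/= linearZ/= !mulmxDl !mulmxDr -!scalemxAl -!scalemxAr.
have pE1 : (v *m (v *m E^T *m E)^T) ord0 ord0 = p v.
  by rewrite /proj_sqnorm !trmx_mul trmxK !mulmxA.
have pE2 : (v *m E^T *m E *m v^T) ord0 ord0 = p v.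
  by rewrite /proj_sqnorm !trmx_mul trmxK !mulmxA.
have pE3 : (v *m E^T *m E *m (v *m E^T *m E)^T) ord0 ord0 = p v.
  rewrite /proj_sqnorm !trmx_mul trmxK !mulmxA.
  by rewrite -[v *m E^T *m E *m E^T]mulmxA EE mulmx1.
rewrite !mxE in pE1 pE2 pE3 *; rewrite pE1 pE2 pE3; ring.
Qed.

Lemma measurable_invr_row (f : 'rV[R]_m -> R) : (forall v, (0 <= f v)%R) ->
  measurable_fun setT (fun x : m.-tuple R => f (rowt x)) ->
  measurable_fun setT (fun x : m.-tuple R => (f (rowt x))^-1)%R.
Proof.
move=> f0 mf.
rewrite (_ : (fun x => _) = (@powR R ^~ (-1)%R) \o (fun x => f (rowt x))).
  exact: (measurableT_comp (measurable_powR (-1)%R) mf).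
by apply/funext => x /=; rewrite powR_inv1.
Qed.

Lemma measurable_sqnorm_mulmx n (M : 'M[R]_(m, n)) : measurable_fun setT
  (fun x : m.-tuple R => (rowt x *m M *m (rowt x *m M)^T) ord0 ord0).
Proof.
under eq_fun do rewrite mxE.
apply: measurable_sum => j; apply: measurable_funM.
  exact: (measurable_row_mulmx M (@measurable_rowt _ _)).
under eq_fun do rewrite mxE.
exact: (measurable_row_mulmx M (@measurable_rowt _ _)).
Qed.

Lemma measurable_proj_sqnorm :
  measurable_fun setT (fun x : m.-tuple R => p (rowt x)).
Proof. exact: measurable_sqnorm_mulmx. Qed.

Lemma measurable_gauss_dens :
  measurable_fun setT (fun x : m.-tuple R => gauss_dens (rowt x)).
Proof. by under eq_fun do rewrite -gauss_pdfE; exact: measurable_gauss_pdf. Qed.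

Lemma measurable_radial_weight :
  measurable_fun setT (fun x : m.-tuple R => weight (rowt x)).
Proof.
have mnrm : measurable_fun setT (fun x : m.-tuple R => nrm (rowt x)).
  by have := measurable_sqnorm_mulmx 1%:M; under eq_fun do rewrite mulmx1.
have mqV := measurable_invr_row q_ge0 mq.
apply: measurable_funM; apply: measurable_funM => //.
  apply: measurableT_comp => //; apply: measurable_funM => //.
  apply: measurable_funN; apply: measurable_funB => //.
  exact: measurable_proj_sqnorm.
by apply: measurableT_comp => //; exact: measurable_funN.
Qed.

(** Such a v is fixed by the dilation by 2, which multiplies q by 4. *)
Lemma form_eq0_of_proj_eq0 v : p v = 0%R -> q v = 0%R.
Proof.
move=> p0; have vE0 : v *m E^T = 0%R by exact: dot_eq0.
have := qE 2%R v; rewrite vE0 mul0mx scaler0 addr0 => q4.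
lra.
Qed.

(** For q > 0, the function exp(-s/q) / q of s is a probability density on the
    half-line; inserting it under the integral and substituting
    [proj_dilation s x] for x turns it into a factor exp(-1/q) / (s q) that no
    longer couples s with q through the exponential.  The integral in s that
    remains is the Gamma integral, up to a rescaling by 2 / |Pi x|^2.  For fixed
    x, the inner integral on the right is, up to normalisation, the probability
    that 2 q(x) / |Pi x|^2 times a Gamma(alpha) variable lies in B. *)
Lemma gamma_mixture (B : set R) : measurable B -> B `<=` `]0%R, +oo[ ->
  \int[powm leb m]_x (\1_B (q (rowt x)) * gauss_dens (rowt x))%:E =
  \int[powm leb m]_x ((weight (rowt x) * (2 / p (rowt x)) `^ alpha)%:E *
    \int[leb]_(u in `]0%R, +oo[)
      (gamma_integrand alpha u * \1_B (2 * q (rowt x) / p (rowt x) * u))%:E).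
Proof.
move=> mB B0.
have mqV := measurable_invr_row q_ge0 mq.
have mp := measurable_proj_sqnorm.
have mgd := measurable_gauss_dens.
have mweight := measurable_radial_weight.
have q_gt0 v : B (q v) -> (0 < q v)%R.
  by move=> /B0 /=; rewrite in_itv/= andbT.
have BE0 v : q v = 0%R -> \1_B (q v) = 0%R :> R.
  move=> q0; rewrite indicE memNset// => /q_gt0.
  by rewrite q0 ltxx.
(* The integrands before and after the dilation by sqrt s. *)
pose Phi1 v s := (\1_B (q v) * gauss_dens v *
  ((q v)^-1 * expR (- ((q v)^-1 * s)) * pos_ind s))%R.
pose Phi2 v s := (weight v *
  (s `^ (alpha - 1) * expR (- (s * p v / 2)) * \1_B (s * q v) * pos_ind s))%R.
have gd0 v : (0 <= gauss_dens v)%R.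
  by rewrite mulr_ge0 ?exprn_ge0 ?normal_peak_ge0 ?expR_ge0.
have w0 v : (0 <= weight v)%R.
  by rewrite !mulr_ge0 ?invr_ge0 ?expR_ge0 ?exprn_ge0 ?normal_peak_ge0.
have Phi1_ge0 v s : (0 <= Phi1 v s)%R.
  by rewrite !mulr_ge0 ?invr_ge0 ?expR_ge0 ?pos_ind_ge0 ?exprn_ge0 ?normal_peak_ge0.
have Phi2_ge0 v s : (0 <= Phi2 v s)%R.
  by rewrite !mulr_ge0 ?invr_ge0 ?expR_ge0 ?powR_ge0 ?pos_ind_ge0 ?exprn_ge0
    ?normal_peak_ge0.
have mB1 : measurable_fun setT (\1_B : R -> R) by exact: measurable_indic.
have powRB1 x : (0 < x)%R -> (x `^ alpha = x `^ (alpha - 1) * x)%R.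
  move=> x0; have x_neq0 : x != 0%R by rewrite gt_eqF.
  by rewrite powRB ?x_neq0 ?implybT// powRr1 ?ltW// divfK.
have mfst (f : m.-tuple R -> R) : measurable_fun setT f ->
    measurable_fun [set: m.-tuple R * R] (fun z => f z.1).
  by move=> mf; exact: (measurableT_comp mf measurable_fst).
have msnd (f : R -> R) : measurable_fun setT f ->
    measurable_fun [set: m.-tuple R * R] (fun z => f z.2).
  by move=> mf; exact: (measurableT_comp mf measurable_snd).
have mexpN d (T : measurableType d) (f : T -> R) : measurable_fun setT f ->
    measurable_fun setT (fun t => expR (- f t)).
  by move=> mf; apply: measurableT_comp => //; exact: measurable_funN.
have mPhi1 : measurable_fun [set: m.-tuple R * R]
    (fun z => (Phi1 (rowt z.1) z.2)%:E).
  apply/measurable_EFinP; apply: measurable_funM; apply: measurable_funM.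
  - exact: (mfst (fun x => \1_B (q (rowt x))) (measurableT_comp mB1 mq)).
  - exact: (mfst _ mgd).
  - apply: measurable_funM; first exact: (mfst _ mqV).
    apply: mexpN; apply: measurable_funM; first exact: (mfst _ mqV).
    exact: measurable_snd.
  - exact: (msnd _ (@measurable_pos_ind _)).
have mgam c : measurable_fun setT
    (fun s : R => (s `^ (alpha - 1) * expR (- (s * c / 2)))%R).
  apply: measurable_funM; first exact: measurable_powR.
  by apply: mexpN; apply: measurable_funM => //; exact: measurable_funM.
have mPhi2 : measurable_fun [set: m.-tuple R * R]
    (fun z => (Phi2 (rowt z.1) z.2)%:E).
  apply/measurable_EFinP; apply: measurable_funM; first exact: (mfst _ mweight).
  apply: measurable_funM; last exact: (msnd _ (@measurable_pos_ind _)).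
  apply: measurable_funM; first apply: measurable_funM.
  - exact: (msnd _ (measurable_powR (alpha - 1))).
  - apply: mexpN; apply: measurable_funM => //; apply: measurable_funM.
      exact: measurable_snd.
    exact: (mfst _ mp).
  - apply: (measurableT_comp mB1); apply: measurable_funM.
      exact: measurable_snd.
    exact: (mfst _ mq).
have fub (G : m.-tuple R * R -> \bar R) :
    measurable_fun [set: m.-tuple R * R] G -> (forall z, 0 <= G z) ->
    \int[powm leb m]_x \int[leb]_s G (x, s) =
    \int[leb]_s \int[powm leb m]_x G (x, s).
  move=> mG G0.
  exact: (@fubini_tonelli _ _ _ _ R (powm leb m) leb G mG G0).
transitivity (\int[powm leb m]_x \int[leb]_s (Phi1 (rowt x) s)%:E).
  apply: eq_integral => x _; set v := rowt x.
  have [qv0|qv0] := eqVneq (q v) 0%R.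
    rewrite BE0// mul0r; symmetry; apply: integral0_eq => s _.
    by rewrite /Phi1 BE0// !mul0r.
  under eq_integral => s _ do rewrite /Phi1 EFinM.
  rewrite ge0_integralZl//; last 3 first.
  - apply/measurable_EFinP; apply: measurable_funM.
      apply: measurable_funM => //; apply: mexpN; exact: measurable_funM.
    exact: measurable_pos_ind.
  - move=> s _; rewrite lee_fin.
    by rewrite !mulr_ge0 ?invr_ge0 ?expR_ge0 ?pos_ind_ge0.
  - by rewrite lee_fin mulr_ge0.
  by rewrite integral_halfline_exp ?mule1// invr_gt0 lt_def qv0 q_ge0.
rewrite (fub (fun z => (Phi1 (rowt z.1) z.2)%:E))//=; last first.
  by move=> z; rewrite lee_fin.
transitivity (\int[leb]_s \int[powm leb m]_x (Phi2 (rowt x) s)%:E).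
  apply: eq_integral => s _.
  have [s_gt0|s_le0] := ltP 0%R s; last first.
    apply: eq_integral => x _; rewrite /Phi1 /Phi2 pos_indE ltNge s_le0.
    by rewrite !mulr0.
  have ts : (0 < Num.sqrt s)%R by rewrite sqrtr_gt0.
  have mf : measurable_fun setT (fun x : m.-tuple R => (Phi1 (rowt x) s)%:E).
    exact: (measurableT_comp mPhi1 (pair2_measurable s)).
  have f0 v : 0 <= (Phi1 v s)%:E by rewrite lee_fin.
  rewrite -(ge0_integral_orthonormal (f := fun v => (Phi1 v s)%:E) ts EE mf f0).
  rewrite -ge0_integralZl//; last first.
    apply: (measurable_comp_row (f := fun v => (Phi1 v s)%:E)) => //.
    apply: measurable_rowD; first exact: measurable_rowt.
    apply: measurable_rowZ; first exact: measurable_cst.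
    do 2! apply: measurable_row_mulmx; exact: measurable_rowt.
  apply: eq_integral => x _; set v := rowt x.
  rewrite -EFinM; congr EFin.
  have s_neq0 : s != 0%R by rewrite gt_eqF.
  rewrite /Phi1 /Phi2 qE sqr_sqrtr ?ltW// invfM.
  have -> : gauss_dens (D s v) =
      (normal_peak 1 ^+ m * expR (- (nrm v - p v) / 2) * expR (- (s * p v / 2)))%R.
    rewrite /gauss_dens sqnorm_proj_dilation ?ltW// -mulrA -expRD.
    by congr (_ * expR _)%R; field.
  have -> : (s^-1 * (q v)^-1 * s = (q v)^-1)%R by rewrite mulrAC mulVf ?mul1r.
  have -> : (Num.sqrt s ^+ r = s `^ (alpha - 1) * s)%R.
    rewrite -powRB1// -powR12_sqrt ?ltW// -powR_mulrn ?powR_ge0// -powRrM.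
    by rewrite mulrC.
  (* The identity is polynomial in (q v)^-1, which may be the inverse of 0. *)
  rewrite /radial_weight; move: ((q v)^-1)%R => k; by field.
rewrite -(fub (fun z => (Phi2 (rowt z.1) z.2)%:E))//=; last first.
  by move=> z; rewrite lee_fin.
apply: eq_integral => x _; set v := rowt x.
have [pv0|pv0] := eqVneq (p v) 0%R.
  have wv0 : weight v = 0%R.
    by rewrite /radial_weight form_eq0_of_proj_eq0// invr0 mul0r mulr0.
  rewrite wv0 !mul0r mul0e; apply: integral0_eq => s _.
  by rewrite /Phi2 wv0 mul0r.
have p_gt0 : (0 < p v)%R by rewrite lt_def pv0; exact: dot_ge0.
under eq_integral => s _ do rewrite /Phi2 EFinM.
rewrite ge0_integralZl//; last 3 first.
- apply/measurable_EFinP; apply: measurable_funM; last exact: measurable_pos_ind.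
  apply: measurable_funM; first exact: (mgam (p v)).
  by apply: (measurableT_comp mB1); exact: measurable_funM.
- move=> s _; rewrite lee_fin.
  by rewrite !mulr_ge0 ?invr_ge0 ?expR_ge0 ?powR_ge0 ?pos_ind_ge0.
- by rewrite lee_fin.
rewrite -(integral_halfline
  (fun s => s `^ (alpha - 1) * expR (- (s * p v / 2)) * \1_B (s * q v))%R).
rewrite (@ge0_integral_dilation R (2 / p v) _ `]0%R, +oo[%classic)//; last 4 first.
- by rewrite divr_gt0.
- by move=> z; rewrite /= !in_itv/= !andbT pmulr_rgt0// divr_gt0.
- apply/measurable_EFinP; apply: measurable_funM; first exact: (mgam (p v)).
  by apply: (measurableT_comp mB1); exact: measurable_funM.
- by move=> s; rewrite lee_fin !mulr_ge0 ?invr_ge0 ?expR_ge0 ?powR_ge0.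
rewrite [in RHS]EFinM -muleA; congr (_ * _).
rewrite -!ge0_integralZl//; last 6 first.
- apply/measurable_EFinP; apply: measurable_funTS.
  apply: measurable_funM; first exact: measurable_gamma_integrand.
  by apply: (measurableT_comp mB1); exact: measurable_funM.
- by move=> s _; rewrite lee_fin mulr_ge0 ?gamma_integrand_ge0.
- by rewrite lee_fin powR_ge0.
- apply/measurable_EFinP; apply: measurable_funTS.
  apply: (measurableT_comp (f := fun z =>
    z `^ (alpha - 1) * expR (- (z * p v / 2)) * \1_B (z * q v))%R).
    apply: measurable_funM; first exact: (mgam (p v)).
    by apply: (measurableT_comp mB1); exact: measurable_funM.
  exact: measurable_funM.
- by move=> s _; rewrite lee_fin !mulr_ge0 ?invr_ge0 ?expR_ge0 ?powR_ge0.
- by rewrite lee_fin divr_ge0// ltW.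
apply: eq_integral => u /[!inE]/= ; rewrite in_itv/= andbT => u0.
rewrite -!EFinM; congr EFin.
rewrite /gamma_integrand powRM ?ltW ?divr_gt0//.
have -> : (2 / p v * u * p v / 2 = u)%R by field.
have -> : (2 / p v * u * q v = 2 * q v / p v * u)%R by field.
rewrite powRB1 ?divr_gt0//.
ring.
Qed.
End gamma_mixture.

(** * The probability that the form is close to a given value *)

Section gaussian_form_bound.
Context (R : realType).
Local Open Scope ereal_scope.
Local Notation leb := (@lebesgue_measure R).
Local Notation gauss := (@normal_prob R 0 1).
Variables (m r : nat) (E : 'M[R]_(r, m)) (q : 'rV[R]_m -> R).
Hypothesis EE : E *m E^T = 1%:M.
Hypothesis mq : measurable_fun setT (fun x : m.-tuple R => q (rowt x)).
Hypothesis q_ge0 : forall v, (0 <= q v)%R.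
Hypothesis qE : forall t v, q (v + (t - 1) *: (v *m E^T *m E))%R = (t ^+ 2 * q v)%R.

Local Notation alpha := (r%:R / 2 : R)%R.

(** The weight of the component of the mixture attached to v, up to the factor
    Gamma(alpha). *)
Definition mixing_density (v : 'rV[R]_m) : R :=
  (radial_weight E q v * (2 / proj_sqnorm E v) `^ alpha)%R.
Local Notation zeta := mixing_density.

Let Z : \bar R := \int[powm leb m]_x (zeta (rowt x))%:E.
Let G : \bar R := \int[leb]_(u in `]0%R, +oo[) (gamma_integrand alpha u)%:E.

Lemma mixing_density_ge0 v : (0 <= zeta v)%R.
Proof.
by rewrite !mulr_ge0 ?invr_ge0 ?expR_ge0 ?powR_ge0 ?exprn_ge0 ?normal_peak_ge0.
Qed.

Lemma powm_gauss_form (B : set R) : measurable B ->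
  powm gauss m [set x | B (q (rowt x))] =
  \int[powm leb m]_x (\1_B (q (rowt x)) * gauss_dens (rowt x))%:E.
Proof.
move=> mB; set S := [set x | _].
have mS : measurable S by rewrite -[S]setTI; exact: mq.
transitivity (\int[powm gauss m]_x (\1_S x)%:E).
  by rewrite integral_indic// setIT.
rewrite ge0_integral_powm_gauss//; last first.
  by apply/measurable_EFinP; exact: measurable_indic.
apply: eq_integral => x _; rewrite -EFinM gauss_pdfE; congr (_ * _)%:E.
Qed.

Lemma powm_gauss_setT : powm gauss m setT = 1.
Proof.
have := @powm_box _ _ R gauss m (fun=> setT) (fun=> measurableT).
rewrite big1 => [<-|i _]; last exact: integral_normal_pdf.
by congr (powm gauss m _); exact/seteqP.
Qed.

Lemma mixing_density_neq0 v : zeta v != 0%R ->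
  (0 < q v)%R /\ (0 < proj_sqnorm E v)%R.
Proof.
have [p0|p0] := eqVneq (proj_sqnorm E v) 0%R.
  rewrite /zeta /radial_weight (form_eq0_of_proj_eq0 qE p0).
  by rewrite invr0 mul0r mulr0 mul0r eqxx.
have [q0|q0] := eqVneq (q v) 0%R.
  by rewrite /zeta /radial_weight q0 invr0 mul0r mulr0 mul0r eqxx.
by rewrite !lt_def q0 p0 q_ge0; split => //; exact: dot_ge0.
Qed.

Lemma measurable_mixing_density :
  measurable_fun setT (fun x : m.-tuple R => (zeta (rowt x))%:E).
Proof.
apply/measurable_EFinP; apply: measurable_funM.
  exact: measurable_radial_weight.
apply: (measurableT_comp (measurable_powR alpha)); apply: measurable_funM => //.
apply: measurable_invr_row; last exact: measurable_proj_sqnorm.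
by move=> v; exact: dot_ge0.
Qed.

(** [gamma_mixture] on the whole half-line: the product is the probability that
    the form is positive. *)
Lemma mixing_mass_gamma : Z * G <= 1.
Proof.
rewrite /Z -ge0_integralZr//; last 3 first.
- exact: measurable_mixing_density.
- by move=> x _; rewrite lee_fin mixing_density_ge0.
- by apply: integral_ge0 => u _; rewrite lee_fin gamma_integrand_ge0.
rewrite (_ : \int[_]_x _ = powm gauss m [set x | `]0%R, +oo[%classic (q (rowt x))]).
  by rewrite -powm_gauss_setT; apply: le_measure => //; rewrite inE//;
    rewrite -[X in measurable X]setTI; exact: mq.
rewrite powm_gauss_form// (gamma_mixture EE mq q_ge0 qE)//.
apply: eq_integral => x _; rewrite -/(zeta _).
have [->|z0] := eqVneq (zeta (rowt x)) 0%R; first by rewrite !mul0e.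
have [q0 p0] := mixing_density_neq0 z0.
congr (_ * _); apply: eq_integral => u /[!inE]/= u0.
rewrite indicE mem_set ?mulr1//=.
move: u0; rewrite !in_itv/= !andbT => u0.
by rewrite !mulr_gt0// invr_gt0.
Qed.

(** In the component of the mixture given by x, the event is that the Gamma
    variable lies in the window of centre c = T |Pi x|^2 / (2 q(x)). *)
Lemma powm_gauss_window_le (eps T : R) (K : \bar R) :
  (0 < eps)%R -> (eps < 1)%R -> (0 < T)%R ->
  (forall c, (0 < c)%R ->
     gamma_mass alpha ((1 - eps) * c)%R ((1 + eps) * c)%R <= K) ->
  powm gauss m [set x | ((1 - eps) * T <= q (rowt x) <= (1 + eps) * T)%R]
    <= Z * K.
Proof.
move=> eps0 eps1 T0 leK.
pose B : set R := `[((1 - eps) * T)%R, ((1 + eps) * T)%R]%classic.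
have lT : (0 < (1 - eps) * T)%R by rewrite mulr_gt0// subr_gt0.
have K0 : 0 <= K.
  apply: le_trans (leK 1%R ltr01); apply: integral_ge0 => u _.
  by rewrite lee_fin gamma_integrand_ge0.
rewrite (_ : [set x | _] = [set x | B (q (rowt x))]); last first.
  by apply/seteqP; split => x; rewrite /B/= in_itv.
rewrite powm_gauss_form; last exact: measurable_itv.
rewrite (gamma_mixture EE mq q_ge0 qE); last 2 first.
- exact: measurable_itv.
- by move=> y; rewrite /B /= !in_itv/= andbT => /andP[/(lt_le_trans lT)].
rewrite /Z -ge0_integralZr//; last 2 first.
- exact: measurable_mixing_density.
- by move=> x _; rewrite lee_fin mixing_density_ge0.
apply: ge0_le_integral => //.
- move=> x _; apply: mule_ge0; first by rewrite lee_fin mixing_density_ge0.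
  by apply: integral_ge0 => u _; rewrite lee_fin mulr_ge0 ?gamma_integrand_ge0.
- apply: emeasurable_funM; first exact: measurable_mixing_density.
  under eq_fun do rewrite integral_halfline.
  apply: (@measurable_fun_fubini_tonelli_F _ _ _ _ R leb
      (fun z : m.-tuple R * R => (gamma_integrand alpha z.2 *
        \1_B (2 * q (rowt z.1) / proj_sqnorm E (rowt z.1) * z.2) *
        pos_ind z.2)%:E)); last first.
    by move=> z; rewrite lee_fin !mulr_ge0 ?powR_ge0 ?expR_ge0 ?pos_ind_ge0.
  apply/measurable_EFinP; apply: measurable_funM; last first.
    exact: (measurableT_comp (@measurable_pos_ind R) measurable_snd).
  apply: measurable_funM.
    exact: (measurableT_comp (measurable_gamma_integrand alpha) measurable_snd).
  apply: (measurableT_comp (measurable_indic (measurable_itv _))).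
  apply: measurable_funM => //.
  have mqp : measurable_fun setT (fun y : m.-tuple R =>
      2 * q (rowt y) / proj_sqnorm E (rowt y))%R.
    apply: measurable_funM; first exact: measurable_funM.
    apply: measurable_invr_row; last exact: measurable_proj_sqnorm.
    by move=> v; exact: dot_ge0.
  exact: (measurableT_comp mqp measurable_fst).
- apply: emeasurable_funM => //; exact: measurable_mixing_density.
move=> x _; rewrite -/(zeta _).
have [->|z0] := eqVneq (zeta (rowt x)) 0%R; first by rewrite !mul0e.
have [q0 p0] := mixing_density_neq0 z0.
apply: lee_wpmul2l; first by rewrite lee_fin mixing_density_ge0.
set v := rowt x in q0 p0 *; set p := proj_sqnorm E v in p0 *.
have c0 : (0 < T * p / (2 * q v))%R by rewrite divr_gt0 ?mulr_gt0.
apply: le_trans (leK _ c0).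
rewrite /gamma_mass [leRHS]integral_itv_obnd_cbnd; last first.
  exact: (measurable_gamma_integrandE alpha).
rewrite le_eqVlt; apply/orP; left; apply/eqP.
rewrite [LHS]integral_mkcond [RHS]integral_mkcond.
apply: eq_integral => u _; rewrite !patchE !mem_setE !in_itv/= andbT indicE.
have -> : (2 * q v / p * u \in B)%R =
    ((1 - eps) * (T * p / (2 * q v)) <= u <= (1 + eps) * (T * p / (2 * q v)))%R.
  rewrite mem_setE in_itv/=.
  rewrite (_ : (2 * q v / p * u = u / (p / (2 * q v)))%R); last first.
    by field; rewrite !gt_eqF.
  rewrite ler_pdivlMr ?ler_pdivrMr ?divr_gt0 ?mulr_gt0//.
  by rewrite !mulrA.
case: (ltP 0%R u) => u0; first by case: ifP => _; rewrite ?mulr1 ?mulr0.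
rewrite ifF//; apply/negP => /andP[+ _]; apply/negP; rewrite -ltNge.
by rewrite (le_lt_trans u0)// mulr_gt0// subr_gt0.
Qed.

(** An event of positive probability makes Gamma(alpha) finite: otherwise
    [mixing_mass_gamma] forces Z = 0, and then [powm_gauss_window_le] gives the
    event probability 0, whatever the bound K.  With Gamma(alpha) finite,
    Z <= 1 / Gamma(alpha) and K can be taken to be the mass of the optimal
    window, which is Gamma(alpha) (1 - Phi). *)
Lemma powm_gauss_window_bound (eps T : R) :
  (0 < eps)%R -> (eps < 1)%R -> (0 < T)%R -> (0 < r)%N ->
  0 < powm gauss m [set x | ((1 - eps) * T <= q (rowt x) <= (1 + eps) * T)%R] ->
  powm gauss m [set x | ((1 - eps) * T <= q (rowt x) <= (1 + eps) * T)%R]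
    <= (1 - Phi eps r%:R)%:E.
Proof.
move=> eps0 eps1 T0 r0; set pr := powm _ _ _ => pr0.
have alpha0 : (0 < alpha)%R by rewrite divr_gt0// ltr0n.
have Z0 : 0 <= Z.
  by apply: integral_ge0 => x _; rewrite lee_fin mixing_density_ge0.
have Goo : G < +oo.
  rewrite ltNge leye_eq; apply/negP => /eqP Goo.
  have pr_le := powm_gauss_window_le eps0 eps1 T0 (fun c _ => leey _).
  have := lt_le_trans pr0 pr_le; have := mixing_mass_gamma; rewrite Goo.
  move: Z0; rewrite le_eqVlt => /predU1P[<-|Z_gt0].
    by rewrite mul0e ltxx.
  by rewrite gt0_muley.
have G'E : \int[leb]_(s in `[0%R, +oo[) (gamma_integrand alpha s)%:E = G.
  apply/esym/integral_itv_obnd_cbnd; exact: measurable_gamma_integrandE.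
have G'oo : \int[leb]_(s in `[0%R, +oo[) (gamma_integrand alpha s)%:E < +oo.
  by rewrite G'E.
set a := ((1 - eps) * (tau eps * alpha))%R.
set b := ((1 + eps) * (tau eps * alpha))%R.
have m0 : (0 < tau eps * alpha)%R by rewrite mulr_gt0// tau_gt0.
have a0 : (0 < a)%R by rewrite mulr_gt0// subr_gt0.
have ab : (a <= b)%R by rewrite ler_pM2r//; lra.
have pr_le : pr <= Z * gamma_mass alpha a b.
  apply: powm_gauss_window_le => // c c0.
  exact: gamma_mass_window_max.
have mass_ge0 : 0 <= gamma_mass alpha a b.
  by apply: integral_ge0 => u _; rewrite lee_fin gamma_integrand_ge0.
have mass_le : gamma_mass alpha a b <= G.
  apply: ge0_subset_integral => //.
  - exact: measurable_gamma_integrandE.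
  - by move=> x _; rewrite lee_fin gamma_integrand_ge0.
  - by move=> x /=; rewrite !in_itv/= andbT => /andP[/(lt_trans a0)].
have G0 : 0 < G.
  rewrite lt0e (le_trans mass_ge0)// andbT; apply/eqP => G0.
  have mass0 : gamma_mass alpha a b = 0.
    by apply/eqP; rewrite eq_le mass_ge0 -G0 mass_le.
  by move: (lt_le_trans pr0 pr_le); rewrite mass0 mule0 ltxx.
have GammaE : G = (Gamma alpha)%:E.
  by rewrite /Gamma /Rintegral G'E fineK// ge0_fin_numE// ltW.
have massE : gamma_mass alpha a b = (fine (gamma_mass alpha a b))%:E.
  by rewrite fineK// ge0_fin_numE// (le_lt_trans mass_le).
have Gamma0 : (0 < Gamma alpha)%R by rewrite -lte_fin -GammaE.
have Z_le : Z <= ((Gamma alpha)^-1)%:E.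
  by rewrite -[leRHS]mul1e lee_pdivlMr// -GammaE mixing_mass_gamma.
apply: (le_trans pr_le); apply: (le_trans (lee_wpmul2r mass_ge0 Z_le)).
rewrite massE -EFinM lee_fin le_eqVlt; apply/orP; left; apply/eqP.
rewrite /Phi /regP /regQ -mulrDl.
rewrite (_ : tau eps * (1 - eps) * r%:R / 2 = a)%R; last by rewrite /a; ring.
rewrite (_ : tau eps * (1 + eps) * r%:R / 2 = b)%R; last by rewrite /b; ring.
have GE := Gamma_split (ltW a0) ab G'oo.
rewrite (_ : lower_gamma _ a + upper_gamma _ b =
  Gamma alpha - fine (gamma_mass alpha a b))%R; last by rewrite GE; ring.
by rewrite mulrBl divff ?gt_eqF// opprB addrC subrK mulrC.
Qed.

End gaussian_form_bound.

(** * The Gaussian sample *)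

Section joint_law.
Context (R : realType) (d : measure_display) (T : measurableType d)
  (P : probability T R) (N n : nat) (w : 'I_N -> 'I_n -> {RV P >-> R}).
Local Open Scope ereal_scope.
Local Notation gauss := (@normal_prob R 0 1).

Definition flat_sample (t : T) : (N * n).-tuple R :=
  [tuple mxvec (\matrix_(i < N, j < n) w i j t) ord0 k | k < N * n].

Lemma rowt_flat_sample t : rowt (flat_sample t) = mxvec (\matrix_(i, j) w i j t).
Proof. by apply/rowP => k; rewrite mxE tnth_mktuple. Qed.

Lemma flat_sampleE t i j : tnth (flat_sample t) (mxvec_index i j) = w i j t.
Proof. by rewrite tnth_mktuple mxvecE mxE. Qed.

Lemma measurable_flat_sample : measurable_fun setT flat_sample.
Proof.
apply/measurable_fun_tnthP => k; case: (mxvec_indexP k) => i j.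
rewrite (_ : _ \o _ = w i j) //.
by apply/funext => t /=; rewrite flat_sampleE.
Qed.

Lemma flat_sample_law (hw : iid_standard_normal_vectors P w)
    (S : set ((N * n).-tuple R)) : measurable S ->
  P (flat_sample @^-1` S) = powm gauss (N * n) S.
Proof.
move=> mS; case: hw => indep std.
pose m' : {measure set ((N * n).-tuple (measurableTypeR R)) -> \bar R} :=
  pushforward P (flat_sample : T -> (N * n).-tuple (measurableTypeR R)).
pose m := m' measurable_flat_sample.
rewrite -[LHS]/(m S).
apply: (@powm_unique _ _ R gauss (N * n)%N m _ _ S mS) => [|B mB].
  by rewrite (_ : _ setT = 1) ?ltry//; exact: integral_normal_pdf.
rewrite /m /m' /= /pushforward.
pose B' (ij : 'I_N * 'I_n) := B (mxvec_index ij.1 ij.2).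
rewrite (_ : _ @^-1` _ = \bigcap_(ij in [set` [set: 'I_N * 'I_n]%SET])
    w ij.1 ij.2 @^-1` B' ij); last first.
  apply/seteqP; split => t /=.
    by move=> h [i j] _ /=; rewrite /B' -flat_sampleE.
  move=> h k; case: (mxvec_indexP k) => i j; rewrite flat_sampleE.
  by apply: (h (i, j)); rewrite /= finset.in_setT.
rewrite (indep _ B')//; last by move=> ij _; exact: mB.
rewrite (reindex _ (curry_mxvec_bij N n))/=.
rewrite big_mkcond/=; apply: eq_bigr => -[i j] _ /=; rewrite finset.in_setT.
exact: (std i j _ (mB _)).
Qed.

End joint_law.

Lemma measurable_rowform (R : realType) N n (A : 'M[R]_n) :
  measurable_fun setT (fun x : (N * n).-tuple R => rowform A (rowt x)).
Proof.
apply: measurable_funM => //; apply: measurable_sum => i.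
under eq_fun do rewrite mxE.
apply: measurable_sum => k; apply: measurable_funM.
  under eq_fun do rewrite mxE.
  apply: measurable_sum => l; apply: measurable_funM => //.
  under eq_fun do rewrite mxE.
  exact: measurable_rowt.
under eq_fun do rewrite !mxE.
exact: measurable_tnth.
Qed.

Unset Implicit Arguments.
Set Strict Implicit.

Theorem theorem5 (R : realType) (n r : nat) (A : 'M[R]_n) (eps delta : R)
    (symA : A^T = A) (psdA : psdmx A) (rankA : \rank A = r) (r_ge1 : (1 <= r)%N)
    (eps_gt0 : 0 < eps) (eps_lt1 : eps < 1)
    (delta_gt0 : 0 < delta) (delta_lt1 : delta < 1)
    (N : nat) (N_gt0 : (0 < N)%N)
    (d : measure_display) (T : measurableType d) (P : probability T R)
    (w : 'I_N -> 'I_n -> {RV P >-> R})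
    (hw : iid_standard_normal_vectors P w)
    (hP : ((1 - delta)%:E <=
      P [set t : T | (`|gaussian_trace (fun i => \col_j w i j t) A - \tr A|
                       <= eps * \tr A)%R])%E) :
  Phi eps (N * r)%:R <= delta.
Proof.
subst r.
have trA0 : 0 < \tr A by exact: psdmx_trace_gt0.
have [E [EE AE]] := exists_orthonormal_row_basis A.
have [E' E'E' qE] := rowform_dilation N symA EE AE.
have gE t : gaussian_trace (fun i => \col_j w i j t) A =
    rowform A (rowt (flat_sample w t)).
  rewrite rowt_flat_sample -rowform_gaussian_trace; congr gaussian_trace.
  by apply/funext => i; apply/colP => j; rewrite !mxE.
pose S := [set x : (N * n).-tuple R |
  (1 - eps) * \tr A <= rowform A (rowt x) <= (1 + eps) * \tr A].
have mS : measurable S.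
  rewrite (_ : S = (fun x => rowform A (rowt x)) @^-1`
    `[(1 - eps) * \tr A, (1 + eps) * \tr A]%classic); last first.
    by apply/seteqP; split => x; rewrite /S /= in_itv.
  by rewrite -[X in measurable X]setTI; exact: measurable_rowform.
have hS : P (flat_sample w @^-1` S) = powm (@normal_prob R 0 1) (N * n) S.
  exact: flat_sample_law.
rewrite (_ : [set t | _] = flat_sample w @^-1` S) in hP; last first.
  have bandE (x : R) : (`|x - \tr A| <= eps * \tr A) =
      ((1 - eps) * \tr A <= x <= (1 + eps) * \tr A).
    by rewrite ler_distl mulrBl mulrDl mul1r.
  by apply/seteqP; split => t; rewrite /S /= gE bandE.
rewrite hS in hP.
have S0 : (0 < powm (@normal_prob R 0 1) (N * n) S)%E.
  by apply: lt_le_trans hP; rewrite lte_fin subr_gt0.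
have q0 (v : 'rV_(N * n)) : 0 <= rowform A v by exact: rowform_ge0.
have Nr0 : (0 < N * \rank A)%N by rewrite muln_gt0 N_gt0.
have := le_trans hP (powm_gauss_window_bound E'E' (@measurable_rowform R N n A)
  q0 qE eps_gt0 eps_lt1 trA0 Nr0 S0).
by rewrite lee_fin lerD2l lerN2.
Qed.
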